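(* For the linear-quadratic data, the functions $(P,\Lambda,H,S,\theta,r)$, $(\Pi_1^o,\Pi_2^o,\theta^o,r^o)$ and the functions $V,\phi,f^*,L^*,\overline U,g$ given in the context, the equation $$\begin{aligned}0=&\ \partial_tU(t,x,\mu)+U_x(t,x,\mu)f^*(t,x,\mu)+\tfrac12{\rm Tr}[U_{xx}(t,x,\mu)(\Sigma+\Sigma_0)]+L^*(t,x,\mu)\\ &+\langle\mu(dy),\partial_y\delta_\mu U(t,x,\mu;y)f^*(t,y,\mu)\rangle+\tfrac12\langle\mu(dy),{\rm Tr}[\partial_y^2\delta_\mu U(t,x,\mu;y)(\Sigma+\Sigma_0)]\rangle\\ &+\langle\mu(dy),{\rm Tr}[\partial_{xy}\delta_\mu U(t,x,\mu;y)\Sigma_0]\rangle+\tfrac12\langle\mu^{\otimes2}(dydz),{\rm Tr}[\partial_{yz}\delta_{\mu\mu}U(t,x,\mu;y,z)\Sigma_0]\rangle\\ &+\langle\mu(dy),\delta_\mu L^*(t,y,\mu;x)-\delta_\mu L^*(t,y,\mu;y)\rangle\\ &+\langle\mu(dy),\partial_y\delta_\mu\overline U(t,\mu;y)[\delta_\mu f^*(t,y,\mu;x)-\delta_\mu f^*(t,y,\mu;y)]\rangle\\ &+\tfrac12\langle\mu(dy),{\rm Tr}\{[\partial_{yz}\delta_{\mu\mu}\overline U(t,\mu;y,z)]|_{z=y}\Sigma\}\rangle\end{aligned}$$ on $[0,T]\times\mathbb R^n\times\mathcal P_2(\mathbb R^n)$, with terminal condition $U(T,x,\mu)=g(x,\mu)+\langle\mu(dy),\delta_\mu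 g(y,\mu;x)-\delta_\mu g(y,\mu;y)\rangle$, has a unique solution within the class of quadratic functions $$U(t,x,\mu)=x^T\Pi_1^\diamond(t)x+\langle\mu(dy),y^T\Pi_2^\diamond(t)y\rangle+\bar x^T\Pi_3^\diamond(t)\bar x+2x^T\Pi_4^\diamond(t)\bar x+2x^TS^\diamond(t)+2\bar x^T\theta^\diamond(t)+r^\diamond(t),$$ ($\bar x=\int y\,\mu(dy)$; $\Pi_1^\diamond,\Pi_2^\diamond,\Pi_3^\diamond$ symmetric), and this solution is $$\begin{aligned}U(t,x,\mu)=&\ x^TPx+\langle\mu(dy),y^T(\Pi_1^o-H-H^T)y\rangle+\bar x^T(\Pi_2^o-\Lambda)\bar x+2x^T(\Lambda+H+H^T)\bar x\\&+2x^T(S+\theta)+2\bar x^T\theta^o+r+r^o.\end{aligned}$$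
   Context: **Notation.** $\mathcal P_2(\mathbb R^n)$: Borel probability measures on $\mathbb R^n$ with finite second moment; $\langle\mu(dy),\psi(y)\rangle=\int\psi\,d\mu$; $\bar x=\langle\mu(dy),y\rangle$, regarded as a function of $\mu$; $|x|_Q^2=x^TQx$. $\partial_x\psi=\psi_x$ is a row vector, $\partial_x^2\psi=\psi_{xx}$ the Hessian, $\partial_{xy}\psi=(\partial_{x_i}\partial_{y_j}\psi)_{i,j}$. For $F(\mu)$ (other arguments fixed), $\delta_\mu F(\mu;y)$ is the function with $\lim_{\epsilon\downarrow0}\epsilon^{-1}[F(\mu+\epsilon(\nu-\mu))-F(\mu)]=\int\delta_\mu F(\mu;y)(\nu-\mu)(dy)$ for all $\nu\in\mathcal P_2(\mathbb R^n)$ and $\int\delta_\mu F(\mu;y)\mu(dy)=0$; $\delta_{\mu\mu}F(\mu;y,z)$ is the derivative of $\mu\mapsto\delta_\mu F(\mu;y)$ with new variable $z$ (componentwise for vector-valued $F$). Partial derivatives refer to the variables as they actually appear. **LQ data.** $A,G,\Gamma,\Gamma_f\in\mathbb R^{n\times n}$, $B\in\mathbb R^{n\times n_1}$, $D\in\mathbb R^{n\times n_2}$, $D_0\in\mathbb R^{n\times n_3}$, $\eta,\eta_f\in\mathbb R^n$, $Q,Q_f\ge0$ and $R>0$ symmetric, $T>0$. $\Sigma=DD^T$, $\Sigma_0=D_0D_0^T$. Drift $f(x,u,\mu)=Ax+Bu+G\bar x$, running cost $L(x,u,\mu)=|x-\Gamma\bar x-\eta|_Q^2+u^TRu$, terminal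 cost $g(x,\mu)=|x-\Gamma_f\bar x-\eta_f|_{Q_f}^2$. Write $K=BR^{-1}B^T$. $(P,\Lambda,H,S,\theta,r)$ is the (unique) solution on $[0,T]$ of $\dot P=-A^TP-PA+PKP-Q$; $\dot\Lambda=-(\Lambda+H)K(\Lambda+H^T)-\Lambda[A+G-K(P+\Lambda+H+H^T)]-[A+G-K(P+\Lambda+H+H^T)]^T\Lambda+H^TKH-H^TG-G^TH-\Gamma^TQ\Gamma$; $\dot H=-A^TH+PKH-H[A+G-K(P+\Lambda+H+H^T)]-PG+Q\Gamma$; $\dot S=-A^TS+PKS+HK(S+\theta)+Q\eta$; $\dot\theta=H^TKS+\Lambda K(S+\theta)-[A+G-K(P+\Lambda+H+H^T)]^T\theta-(\Lambda+H)K\theta-G^TS-\Gamma^TQ\eta$; $\dot r=S^TKS+\theta^TK(2S+\theta)-{\rm Tr}[(P+\Lambda+H+H^T)D_0D_0^T]-{\rm Tr}(PDD^T)-\eta^TQ\eta$; with $P(T)=Q_f$, $\Lambda(T)=\Gamma_f^TQ_f\Gamma_f$, $H(T)=-Q_f\Gamma_f$, $S(T)=-Q_f\eta_f$, $\theta(T)=\Gamma_f^TQ_f\eta_f$, $r(T)=\eta_f^TQ_f\eta_f$ ($P,\Lambda$ symmetric). Define $V(t,x,\mu)=x^TPx+\bar x^T\Lambda\bar x+2x^TH\bar x+2x^TS+2\bar x^T\theta+r$, $\phi(t,x,\mu)=-R^{-1}B^T[Px+(\Lambda+H+H^T)\bar x+S+\theta]$, $f^*(t,x,\mu)=f(x,\phi(t,x,\mu),\mu)$,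 $L^*(t,x,\mu)=L(x,\phi(t,x,\mu),\mu)$, $\overline U(t,\mu)=\langle\mu(dy),V(t,y,\mu)\rangle$, and $\widehat G=G-K(\Lambda+H+H^T)$. $(\Pi_1^o,\Pi_2^o,\theta^o,r^o)$ is the (unique) solution on $[0,T]$ of the linear system $\dot\Pi_1^o=-\Pi_1^o(A-KP)-(A-KP)^T\Pi_1^o-(H\widehat G+\widehat G^TH^T)$; $\dot\Pi_2^o=-\Pi_2^o(A+\widehat G-KP)-(A+\widehat G-KP)^T\Pi_2^o-\Pi_1^o\widehat G-\widehat G^T\Pi_1^o+H\widehat G+\widehat G^TH^T$; $\dot\theta^o=-(A+\widehat G-KP)^T\theta^o+(\Pi_1^o+\Pi_2^o)K(S+\theta)$; $\dot r^o=2\theta^{oT}K(S+\theta)-{\rm Tr}[(\Pi_1^o+\Lambda)DD^T+(\Pi_1^o+\Pi_2^o)D_0D_0^T]$; with zero terminal conditions at $T$. The coefficients $\Pi_i^\diamond,S^\diamond,\theta^\diamond,r^\diamond$ in the quadratic class are differentiable functions of $t\in[0,T]$ with values in $\mathbb R^{n\times n}$, $\mathbb R^n$, $\mathbb R^n$, $\mathbb R$. *)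

(* Defs.v *)
From HB Require Import structures.
From mathcomp Require Import all_boot all_order all_algebra.
From mathcomp Require Import all_classical all_reals all_analysis.
From mathcomp Require Import measurable_realfun.
Set Implicit Arguments.
Unset Strict Implicit.
Unset Printing Implicit Defensive.
Import Order.TTheory GRing.Theory Num.Theory.
Import numFieldNormedType.Exports.
Local Open Scope classical_set_scope.
Local Open Scope ring_scope.

Definition dot (R : realType) (n : nat) (u v : 'cV[R]_n) : R :=
  (u^T *m v) 0 0.

Definition quad (R : realType) (n : nat) (M : 'M[R]_n) (x : 'cV[R]_n) : R :=
  dot x (M *m x).

Definition sym_mx (R : realType) (n : nat) (M : 'M[R]_n) : Prop := M^T = M.

Definition psd (R : realType) (n : nat) (M : 'M[R]_n) : Prop :=
  sym_mx M /\ forall x : 'cV[R]_n, 0 <= quad M x.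

Definition pd (R : realType) (n : nat) (M : 'M[R]_n) : Prop :=
  sym_mx M /\ forall x : 'cV[R]_n, x != 0 -> 0 < quad M x.

(* R^n with its Borel sigma-algebra; the carrier is convertible to 'cV[R]_n. *)
Definition borelRn (R : realType) (n : nat) : Type :=
  g_sigma_algebraType (@open 'cV[R]_n).
HB.instance Definition _ (R : realType) (n : nat) :=
  Measurable.copy (borelRn R n) (g_sigma_algebraType (@open 'cV[R]_n)).

Record P2 (R : realType) (n : nat) := MkP2 {
  P2_law :> probability (borelRn R n) R ;
  P2_moment : (\int[P2_law]_y (dot (y : 'cV[R]_n) y)%:E < +oo)%E }.

Definition mean (R : realType) (n : nat) (mu : P2 R n) : 'cV[R]_n :=
  \col_i \int[mu]_y (y : 'cV[R]_n) i 0.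

(* The mixture mu + e (nu - mu). So that it is defined for every real e, the
   weight is clamped to [0, 1]; only 0 < e < 1 matters below. *)
Section Mixture.
Context (R : realType) (n : nat).

Definition clamp (e : R) : R := Num.max 0 (Num.min e 1).

Lemma clamp_ge0 (e : R) : 0 <= clamp e.
Proof. by rewrite le_max lexx. Qed.

Lemma clamp_le1 (e : R) : clamp e <= 1.
Proof. by rewrite ge_max ler01 ge_min lexx orbT. Qed.

Lemma clampC_ge0 (e : R) : 0 <= 1 - clamp e.
Proof. by rewrite subr_ge0 clamp_le1. Qed.

Definition mix_law (mu nu : P2 R n) (e : R) : set (borelRn R n) -> \bar R :=
  measure_add (mscale (NngNum (clampC_ge0 e)) mu)
              (mscale (NngNum (clamp_ge0 e)) nu).

HB.instance Definition _ (mu nu : P2 R n) (e : R) :=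
  Measure.on (mix_law mu nu e).

Lemma mix_law_setT (mu nu : P2 R n) (e : R) : mix_law mu nu e setT = 1%E.
Proof.
rewrite /mix_law measure_addE/=.
by rewrite /mscale /= !probability_setT !mule1 -EFinD subrK.
Qed.

HB.instance Definition _ (mu nu : P2 R n) (e : R) :=
  Measure_isProbability.Build _ _ R (mix_law mu nu e) (mix_law_setT mu nu e).

Lemma continuous_measurable_borelRn (f : 'cV[R]_n -> R) :
  continuous f -> measurable_fun [set: borelRn R n] f.
Proof.
move=> cf; apply: (measurability _ (RGenOpens.measurableE R)) => _ [_ [a [b ->]] <-].
rewrite setTI; apply: sub_sigma_algebra.
by apply: (open_comp (f := f)) => [x _|]; [exact: cf|exact: interval_open].
Qed.

Lemma measurable_coord (i : 'I_n) :
  measurable_fun [set: borelRn R n] ((fun y : 'cV[R]_n => y i 0) : _ -> R).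
Proof. by apply: continuous_measurable_borelRn; exact: coord_continuous. Qed.

Lemma dotE (u v : 'cV[R]_n) : dot u v = \sum_i u i 0 * v i 0.
Proof. by rewrite /dot mxE; apply: eq_bigr => i _; rewrite mxE. Qed.

Lemma dot_ge0 (y : 'cV[R]_n) : 0 <= dot y y.
Proof. by rewrite dotE sumr_ge0 // => i _; rewrite -expr2 sqr_ge0. Qed.

Lemma measurable_dot :
  measurable_fun [set: borelRn R n] ((fun y : 'cV[R]_n => dot y y) : _ -> R).
Proof.
have -> : (fun y : 'cV[R]_n => dot y y) = fun y => \sum_i y i 0 * y i 0.
  by apply/funext => y; rewrite dotE.
by apply: measurable_sum => i; apply: measurable_funM; exact: measurable_coord.
Qed.

Lemma mix_moment (mu nu : P2 R n) (e : R) :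
  (\int[mix_law mu nu e]_y (dot (y : 'cV[R]_n) y)%:E < +oo)%E.
Proof.
have d0 (y : borelRn R n) : [set: borelRn R n] y -> (0 <= (dot (y : 'cV[R]_n) y)%:E)%E.
  by rewrite lee_fin dot_ge0.
have /measurable_EFinP md := measurable_dot.
rewrite ge0_integral_measure_add// !ge0_integral_mscale//=.
rewrite lte_add_pinfty// lte_mul_pinfty ?lee_fin ?clampC_ge0 ?clamp_ge0//;
  exact: P2_moment.
Qed.

Definition mix (mu nu : P2 R n) (e : R) : P2 R n := MkP2 (mix_moment mu nu e).

End Mixture.

(* Difference quotient along s -> t within [0, T]: one-sided at 0 and T. *)
Definition quot_on (R : realType) (W : normedModType R) (T : R) (f : R -> W)
    (t : R) : set_system W :=
  (fun s : R => (s - t)^-1 *: (f s - f t)) @ within `[0, T] t^'.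

Definition derivable_on (R : realType) (W : normedModType R) (T : R)
    (f : R -> W) : Prop :=
  forall t : R, 0 <= t <= T -> cvg (quot_on T f t).

Definition deriv_on (R : realType) (W : normedModType R) (T : R) (f : R -> W)
    (t : R) : W := lim (quot_on T f t).

Definition ode_on (R : realType) (W : normedModType R) (T : R)
    (f v : R -> W) : Prop :=
  forall t : R, 0 <= t <= T -> quot_on T f t --> v t.

Section Derivatives.
Context (R : realType) (n : nat).

Definition pderiv (i : 'I_n) (f : 'cV[R]_n -> R) (x : 'cV[R]_n) : R :=
  'D_(delta_mx i 0) f x.

Definition grad (f : 'cV[R]_n -> R) (x : 'cV[R]_n) : 'rV[R]_n :=
  \row_i pderiv i f x.

Definition hess (f : 'cV[R]_n -> R) (x : 'cV[R]_n) : 'M[R]_n :=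
  \matrix_(i, j) pderiv i (pderiv j f) x.

Definition mixed (f : 'cV[R]_n -> 'cV[R]_n -> R) (x y : 'cV[R]_n) : 'M[R]_n :=
  \matrix_(i, j) pderiv i (fun x' => pderiv j (f x') y) x.

(* The requirement that d be integrable makes the limit condition meaningful:
   Rintegral is a junk value for non-integrable functions. *)
Definition is_delta (F : P2 R n -> R) (mu : P2 R n) (d : 'cV[R]_n -> R) : Prop :=
  [/\ forall nu : P2 R n,
        (P2_law nu).-integrable [set: borelRn R n] (EFin \o d),
      \int[mu]_y d y = 0 &
      forall nu : P2 R n,
        e^-1 * (F (mix mu nu e) - F mu) @[e --> 0^'+] -->
          \int[nu]_y d y - \int[mu]_y d y].

(* Testing with Dirac masses nu shows that at most one d satisfies is_delta. *)
Definition delta (F : P2 R n -> R) (mu : P2 R n) : 'cV[R]_n -> R :=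
  xget (fun=> 0) [set d | is_delta F mu d].

Definition delta2 (F : P2 R n -> R) (mu : P2 R n) (y z : 'cV[R]_n) : R :=
  delta (fun m => delta F m y) mu z.

Definition delta_vec (F : P2 R n -> 'cV[R]_n) (mu : P2 R n) (y : 'cV[R]_n) :
    'cV[R]_n :=
  \col_i delta (fun m => F m i 0) mu y.

End Derivatives.

Record lq_data (R : realType) (n n1 n2 n3 : nat) := LQData {
  lqA : 'M[R]_n ;
  lqG : 'M[R]_n ;
  lqGam : 'M[R]_n ;
  lqGamf : 'M[R]_n ;
  lqB : 'M[R]_(n, n1) ;
  lqD : 'M[R]_(n, n2) ;
  lqD0 : 'M[R]_(n, n3) ;
  lqeta : 'cV[R]_n ;
  lqetaf : 'cV[R]_n ;
  lqQ : 'M[R]_n ;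
  lqQf : 'M[R]_n ;
  lqR : 'M[R]_n1 ;
  lqQ_psd : psd lqQ ;
  lqQf_psd : psd lqQf ;
  lqR_pd : pd lqR }.

Record riccati_fun (R : realType) (n : nat) := RiccatiFun {
  rP : R -> 'M[R]_n ;
  rLam : R -> 'M[R]_n ;
  rH : R -> 'M[R]_n ;
  rS : R -> 'cV[R]_n ;
  rth : R -> 'cV[R]_n ;
  rr : R -> R }.

Record linear_fun (R : realType) (n : nat) := LinearFun {
  oPi1 : R -> 'M[R]_n ;
  oPi2 : R -> 'M[R]_n ;
  oth : R -> 'cV[R]_n ;
  oor : R -> R }.

Section LQ.
Context (R : realType) (n n1 n2 n3 : nat) (lq : lq_data R n n1 n2 n3).

Let A := lqA lq.
Let G := lqG lq.
Let Gam := lqGam lq.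
Let Gamf := lqGamf lq.
Let B := lqB lq.
Let D := lqD lq.
Let D0 := lqD0 lq.
Let eta := lqeta lq.
Let etaf := lqetaf lq.
Let Q := lqQ lq.
Let Qf := lqQf lq.
Let Rw := lqR lq.

Definition Sig : 'M[R]_n := D *m D^T.
Definition Sig0 : 'M[R]_n := D0 *m D0^T.
Definition lqK : 'M[R]_n := B *m invmx Rw *m B^T.
Let K := lqK.

Definition drift (x : 'cV[R]_n) (u : 'cV[R]_n1) (mu : P2 R n) : 'cV[R]_n :=
  A *m x + B *m u + G *m mean mu.

Definition run_cost (x : 'cV[R]_n) (u : 'cV[R]_n1) (mu : P2 R n) : R :=
  quad Q (x - Gam *m mean mu - eta) + quad Rw u.

Definition term_cost (x : 'cV[R]_n) (mu : P2 R n) : R :=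
  quad Qf (x - Gamf *m mean mu - etaf).

Definition is_riccati_solution (T : R) (c : riccati_fun R n) : Prop :=
  let P := rP c in let Lam := rLam c in let H := rH c in
  let S := rS c in let th := rth c in let r := rr c in
  let F t := A + G - K *m (P t + Lam t + H t + (H t)^T) in
  [/\ [/\ ode_on T P (fun t =>
            - (A^T *m P t) - P t *m A + P t *m K *m P t - Q),
          ode_on T Lam (fun t =>
            - ((Lam t + H t) *m K *m (Lam t + (H t)^T))
            - Lam t *m F t - (F t)^T *m Lam t
            + (H t)^T *m K *m H t - (H t)^T *m G - G^T *m H t
            - Gam^T *m Q *m Gam) &
          ode_on T H (fun t =>
            - (A^T *m H t) + P t *m K *m H t - H t *m F t
            - P t *m G + Q *m Gam)],
      [/\ ode_on T S (fun t =>
            - (A^T *m S t) + P t *m K *m S t + H t *m K *m (S t + th t)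
            + Q *m eta),
          ode_on T th (fun t =>
            (H t)^T *m K *m S t + Lam t *m K *m (S t + th t)
            - (F t)^T *m th t - (Lam t + H t) *m K *m th t
            - G^T *m S t - Gam^T *m Q *m eta) &
          ode_on T r (fun t =>
            quad K (S t) + dot (th t) (K *m (2 *: S t + th t))
            - \tr ((P t + Lam t + H t + (H t)^T) *m D0 *m D0^T)
            - \tr (P t *m D *m D^T) - quad Q eta)],
      [/\ P T = Qf, Lam T = Gamf^T *m Qf *m Gamf & H T = - (Qf *m Gamf)],
      [/\ S T = - (Qf *m etaf), th T = Gamf^T *m Qf *m etaf &
          r T = quad Qf etaf] &
      forall t : R, 0 <= t <= T -> sym_mx (P t) /\ sym_mx (Lam t)].

Section Fixed_riccati.
Context (c : riccati_fun R n).

Let P := rP c.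
Let Lam := rLam c.
Let H := rH c.
Let S := rS c.
Let th := rth c.
Let r := rr c.

Definition Ghat (t : R) : 'M[R]_n := G - K *m (Lam t + H t + (H t)^T).

Definition is_linear_solution (T : R) (o : linear_fun R n) : Prop :=
  let Pi1 := oPi1 o in let Pi2 := oPi2 o in
  let tho := oth o in let ro := oor o in
  let E t := A - K *m P t in
  let F t := A + Ghat t - K *m P t in
  [/\ ode_on T Pi1 (fun t =>
        - (Pi1 t *m E t) - (E t)^T *m Pi1 t
        - (H t *m Ghat t + (Ghat t)^T *m (H t)^T)),
      ode_on T Pi2 (fun t =>
        - (Pi2 t *m F t) - (F t)^T *m Pi2 t
        - Pi1 t *m Ghat t - (Ghat t)^T *m Pi1 t
        + H t *m Ghat t + (Ghat t)^T *m (H t)^T),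
      ode_on T tho (fun t =>
        - ((F t)^T *m tho t) + (Pi1 t + Pi2 t) *m K *m (S t + th t)),
      ode_on T ro (fun t =>
        2 * dot (tho t) (K *m (S t + th t))
        - \tr ((Pi1 t + Lam t) *m D *m D^T
               + (Pi1 t + Pi2 t) *m D0 *m D0^T)) &
      [/\ Pi1 T = 0, Pi2 T = 0, tho T = 0 & ro T = 0]].

Definition V (t : R) (x : 'cV[R]_n) (mu : P2 R n) : R :=
  quad (P t) x + quad (Lam t) (mean mu) + 2 * dot x (H t *m mean mu)
  + 2 * dot x (S t) + 2 * dot (mean mu) (th t) + r t.

Definition phi (t : R) (x : 'cV[R]_n) (mu : P2 R n) : 'cV[R]_n1 :=
  - (invmx Rw *m B^T *m
     (P t *m x + (Lam t + H t + (H t)^T) *m mean mu + S t + th t)).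

Definition fstar (t : R) (x : 'cV[R]_n) (mu : P2 R n) : 'cV[R]_n :=
  drift x (phi t x mu) mu.

Definition Lstar (t : R) (x : 'cV[R]_n) (mu : P2 R n) : R :=
  run_cost x (phi t x mu) mu.

Definition Ubar (t : R) (mu : P2 R n) : R := \int[mu]_y V t y mu.

(* deriv_on, grad, hess, mixed, delta and the integrals are total, with junk
   values where the limit or integral does not exist.  This is harmless for U
   in quadratic_class: each derivative then exists and each integrand is at
   most quadratic in y, hence integrable. *)
Definition master_rhs (T : R) (U : R -> 'cV[R]_n -> P2 R n -> R)
    (t : R) (x : 'cV[R]_n) (mu : P2 R n) : R :=
  deriv_on T (fun s => U s x mu) t
  + (grad (fun x' => U t x' mu) x *m fstar t x mu) 0 0
  + 2^-1 * \tr (hess (fun x' => U t x' mu) x *m (Sig + Sig0))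
  + Lstar t x mu
  + \int[mu]_y ((grad (delta (U t x) mu) y *m fstar t y mu) 0 0)
  + 2^-1 * \int[mu]_y \tr (hess (delta (U t x) mu) y *m (Sig + Sig0))
  + \int[mu]_y \tr (mixed (fun x' => delta (U t x') mu) x y *m Sig0)
  + 2^-1 * \int[(P2_law mu \x P2_law mu)%E]_yz
      \tr (mixed (delta2 (U t x) mu) yz.1 yz.2 *m Sig0)
  + \int[mu]_y (delta (Lstar t y) mu x - delta (Lstar t y) mu y)
  + \int[mu]_y ((grad (delta (Ubar t) mu) y *m
      (delta_vec (fstar t y) mu x - delta_vec (fstar t y) mu y)) 0 0)
  + 2^-1 * \int[mu]_y \tr (mixed (delta2 (Ubar t) mu) y y *m Sig).

Definition is_master_solution (T : R) (U : R -> 'cV[R]_n -> P2 R n -> R) : Prop :=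
  (forall t x mu, 0 <= t <= T -> 0 = master_rhs T U t x mu) /\
  (forall x mu, U T x mu =
     term_cost x mu
     + \int[mu]_y (delta (term_cost y) mu x - delta (term_cost y) mu y)).

End Fixed_riccati.
End LQ.

Section QuadraticClass.
Context (R : realType) (n : nat).

Definition quadratic_fun (Pi1 Pi2 Pi3 Pi4 : R -> 'M[R]_n)
    (S th : R -> 'cV[R]_n) (r : R -> R)
    (t : R) (x : 'cV[R]_n) (mu : P2 R n) : R :=
  quad (Pi1 t) x + \int[mu]_y quad (Pi2 t) y + quad (Pi3 t) (mean mu)
  + 2 * dot x (Pi4 t *m mean mu) + 2 * dot x (S t)
  + 2 * dot (mean mu) (th t) + r t.

Definition quadratic_class (T : R) (U : R -> 'cV[R]_n -> P2 R n -> R) : Prop :=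
  exists (Pi1 Pi2 Pi3 Pi4 : R -> 'M[R]_n) (S th : R -> 'cV[R]_n) (r : R -> R),
  [/\ [/\ derivable_on T Pi1, derivable_on T Pi2, derivable_on T Pi3 &
          derivable_on T Pi4],
      [/\ derivable_on T S, derivable_on T th &
          derivable_on T r],
      forall t, 0 <= t <= T ->
        [/\ sym_mx (Pi1 t), sym_mx (Pi2 t) & sym_mx (Pi3 t)] &
      forall t x mu, 0 <= t <= T ->
        U t x mu = quadratic_fun Pi1 Pi2 Pi3 Pi4 S th r t x mu].

End QuadraticClass.

(* Main.v *)
(* On the quadratic class every term of the master equation is again a
   quadratic function of (x, mu) through x, the second moment and the mean of
   mu, so the equation says that the coefficients of one quadratic form
   ([master_coefs]) vanish.  Dirac masses and centred two-point measures show
   that a quadratic form in (x, mu) determines its coefficients, up to the skew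
   parts of the quadratic ones, so the master equation is equivalent to a
   linear system of matrix ODEs.  The stated coefficients solve it by the
   Riccati equations.  The difference of two solutions with the same terminal
   value solves a homogeneous triangular system, whose equations have the form
   Z' = F Z + Z G with Z(T) = 0 when taken in the order Pi_1, Pi_2, Pi_4, Pi_3,
   S, theta, r, and Gronwall's inequality makes each Z vanish. *)

Require Import Defs.
From mathcomp Require Import all_boot all_order all_algebra.
From mathcomp Require Import all_classical all_reals all_analysis.
From mathcomp Require Import measurable_realfun ring lra.
Set Implicit Arguments.
Unset Strict Implicit.
Unset Printing Implicit Defensive.
Import Order.TTheory GRing.Theory Num.Theory.
Import numFieldNormedType.Exports.
Local Open Scope classical_set_scope.
Local Open Scope ring_scope.

(** * Quadratic forms and moments *)

(** The stated solution is $V$ plus $\langle\mu(dy),\delta_\mu V(t,y,\mu;x)-\delta_\mu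
    V(t,y,\mu;y)\rangle$, the same transform that turns $g$ into the terminal condition, plus a
    function of $(t,\mu)$ alone. The coefficients of the latter are $\Pi_1^o,\Pi_2^o,\theta^o,r^o$;
    they start from zero at $T$ because $V(T)=g$. The operators [delta], [grad], [deriv_on] and the
    like are defined by choice or as limits, so each occurrence has to be evaluated before any
    algebra can start. One class of functionals suffices for this: [m] goes to the integral of
    [quad M] plus [quad N (mean m) + dot b (mean m) + c]. It contains $U$ at fixed $x$, the
    components of $f^*$, and $L^*$, $\overline U$ and $g$; and with [F] it contains [delta F m y] as
    a function of [m], which gives the second derivatives. For the three symmetric coefficients the
    equation gives [X + X^T = 0] only. Existence has just this to check. Uniqueness needs an
    equation for the derivative itself, and obtains it because the derivative of a symmetric path is
    symmetric. *)

Section DotQuad.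
Context (R : realType) (n : nat).
Implicit Types (u v w x y : 'cV[R]_n) (M N : 'M[R]_n).

Lemma dotC u v : dot u v = dot v u.
Proof. by rewrite !dotE; apply: eq_bigr => i _; rewrite mulrC. Qed.

Lemma dotDr u v w : dot u (v + w) = dot u v + dot u w.
Proof. by rewrite /dot mulmxDr mxE. Qed.

Lemma dotDl u v w : dot (u + v) w = dot u w + dot v w.
Proof. by rewrite !(dotC _ w) dotDr. Qed.

Lemma dotZr a u v : dot u (a *: v) = a * dot u v.
Proof. by rewrite /dot -scalemxAr mxE. Qed.

Lemma dotZl a u v : dot (a *: u) v = a * dot u v.
Proof. by rewrite !(dotC _ v) dotZr. Qed.

Lemma dotNr u v : dot u (- v) = - dot u v.
Proof. by rewrite -scaleN1r dotZr mulN1r. Qed.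

Lemma dotNl u v : dot (- u) v = - dot u v.
Proof. by rewrite !(dotC _ v) dotNr. Qed.

Lemma dot0r u : dot u 0 = 0.
Proof. by rewrite /dot mulmx0 mxE. Qed.

Lemma dot0l u : dot 0 u = 0.
Proof. by rewrite dotC dot0r. Qed.

Lemma dot_mull (k : nat) (M : 'M[R]_(n, k)) (u : 'cV[R]_k) v :
  dot (M *m u) v = dot u (M^T *m v).
Proof. by rewrite /dot trmx_mul mulmxA. Qed.

Lemma dot_flip u v M : dot u (M *m v) = dot v (M^T *m u).
Proof. by rewrite dotC dot_mull. Qed.

Lemma dot_delta (i : 'I_n) u : dot (delta_mx i 0) u = u i 0.
Proof.
rewrite dotE (bigD1 i)//= !mxE !eqxx mul1r big1 ?addr0// => j ji.
by rewrite !mxE (negbTE ji) mul0r.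
Qed.

Lemma dot_eq0 u : (forall v, dot v u = 0) -> u = 0.
Proof.
by move=> u0; apply/colP => i; rewrite -dot_delta u0 mxE.
Qed.

Lemma bilin_eq0 M : (forall u v, dot u (M *m v) = 0) -> M = 0.
Proof.
move=> M0; apply/matrixP => i j; have := M0 (delta_mx i 0) (delta_mx j 0).
by rewrite dot_delta -colE !mxE.
Qed.

Lemma quadDl M N x : quad (M + N) x = quad M x + quad N x.
Proof. by rewrite /quad mulmxDl dotDr. Qed.

Lemma quadZl a M x : quad (a *: M) x = a * quad M x.
Proof. by rewrite /quad -scalemxAl dotZr. Qed.

Lemma quadNl M x : quad (- M) x = - quad M x.
Proof. by rewrite /quad mulNmx dotNr. Qed.

Lemma quad0l x : quad 0 x = 0.
Proof. by rewrite /quad mul0mx dot0r. Qed.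

Lemma quad_tr M x : quad M^T x = quad M x.
Proof. by rewrite /quad -dot_flip. Qed.

Lemma quadD M x y : quad M (x + y) = quad M x + dot ((M + M^T) *m x) y + quad M y.
Proof.
rewrite /quad mulmxDr !dotDl !dotDr dot_mull linearD/= trmxK mulmxDl dotDr.
by rewrite [dot y (M *m x)]dot_flip; ring.
Qed.

Lemma quadZ a M x : quad M (a *: x) = a ^+ 2 * quad M x.
Proof. by rewrite /quad -scalemxAr dotZl dotZr expr2 mulrA. Qed.

Lemma quadN M x : quad M (- x) = quad M x.
Proof. by rewrite -scaleN1r quadZ sqrrN expr1n mul1r. Qed.

(** Polarisation: expanding [quad M (u + v)] leaves the bilinear form of [M + M^T]. The skew part of
    [M] is invisible to [quad], hence this conclusion rather than [M = 0]. *)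
Lemma quad_eq0 M : (forall x, quad M x = 0) -> M + M^T = 0.
Proof.
move=> M0; apply: bilin_eq0 => u v.
rewrite dot_flip linearD/= trmxK addrC dotC.
by have := quadD M u v; rewrite !M0 add0r addr0 => <-.
Qed.

End DotQuad.

Section Moments.
Context (R : realType) (n : nat).
Implicit Types (mu nu : P2 R n) (x y b : 'cV[R]_n) (M N : 'M[R]_n).

Lemma integrable_cst mu (a : R) :
  (P2_law mu).-integrable [set: borelRn R n] (EFin \o cst a).
Proof. exact: finite_measure_integrable_cst. Qed.

Lemma measurable_coordM (i j : 'I_n) : measurable_fun [set: borelRn R n]
  ((fun y : 'cV[R]_n => y i 0 * y j 0) : _ -> R).
Proof. by apply: measurable_funM; exact: measurable_coord. Qed.

Lemma integrable_dot mu :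
  (P2_law mu).-integrable [set: borelRn R n]
    (fun y => (dot (y : 'cV[R]_n) y)%:E).
Proof.
apply/integrableP; split; first by apply/measurable_EFinP; exact: measurable_dot.
under eq_integral do rewrite /= ger0_norm ?dot_ge0//.
exact: P2_moment.
Qed.

Lemma le_dot_coord y (i : 'I_n) : y i 0 ^+ 2 <= dot y y.
Proof.
by rewrite dotE (bigD1 i)//= expr2 lerDl sumr_ge0// => j _; rewrite -expr2 sqr_ge0.
Qed.

Lemma integrable_coordM mu (i j : 'I_n) :
  (P2_law mu).-integrable [set: borelRn R n]
    (EFin \o (fun y : 'cV[R]_n => y i 0 * y j 0)).
Proof.
apply: (le_integrable measurableT _ _ (integrable_dot mu)).
  by apply/measurable_EFinP; exact: measurable_coordM.
move=> y _ /=; rewrite lee_fin [leRHS]ger0_norm ?dot_ge0//.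
(* [|a b| <= (a^2 + b^2) / 2], and both squares are at most [dot y y]. *)
have := le_dot_coord y i; have := le_dot_coord y j.
by case: ler0P => _; nra.
Qed.

Lemma integrable_coord mu (i : 'I_n) :
  (P2_law mu).-integrable [set: borelRn R n]
    (EFin \o (fun y : 'cV[R]_n => y i 0)).
Proof.
(* [|a| <= 1 + a^2]: the total mass and the second moment dominate the first moment. *)
have h : (P2_law mu).-integrable [set: borelRn R n]
    (EFin \o (fun y : 'cV[R]_n => 1 + y i 0 * y i 0)).
  apply: eq_integrable (integrableD measurableT (integrable_cst mu 1)
    (integrable_coordM mu i i)) => //.
apply: (le_integrable measurableT _ _ h).
  by apply/measurable_EFinP; exact: measurable_coord.
move=> y _ /=; rewrite lee_fin.
rewrite [leRHS]ger0_norm; last by rewrite addr_ge0// -expr2 sqr_ge0.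
by case: ler0P => _; nra.
Qed.

Lemma integrable_quadratic mu M b (c : R) :
  (P2_law mu).-integrable [set: borelRn R n]
    (EFin \o (fun y : 'cV[R]_n => quad M y + dot b y + c)).
Proof.
have hq : (P2_law mu).-integrable [set: borelRn R n]
    (fun y : 'cV[R]_n => \sum_i \sum_j ((M i j)%:E * (y i 0 * y j 0)%:E)%E)%E.
  apply: integrable_sum => // i _; apply: integrable_sum => // j _.
  exact: integrableZl (integrable_coordM mu i j).
have hd : (P2_law mu).-integrable [set: borelRn R n]
    (fun y : 'cV[R]_n => \sum_i ((b i 0)%:E * (y i 0)%:E)%E)%E.
  apply: integrable_sum => // i _.
  exact: integrableZl (integrable_coord mu i).
apply: eq_integrable (integrableD measurableT (integrableD measurableT hq hd)
  (integrable_cst mu c)) => // y _ /=.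
rewrite !EFinD /quad !dotE -!sumEFin; congr (_ + _ + _)%E.
apply: eq_bigr => i _; rewrite mxE mulr_sumr -sumEFin; apply: eq_bigr => j _.
by rewrite -EFinM; congr _%:E; ring.
Qed.

Lemma integrable_quad mu M :
  (P2_law mu).-integrable [set: borelRn R n] (EFin \o (quad M)).
Proof.
apply: eq_integrable (integrable_quadratic mu M 0 0) => // y _ /=.
by rewrite dot0l !addr0.
Qed.

Lemma integrable_dotl mu b :
  (P2_law mu).-integrable [set: borelRn R n] (EFin \o (dot b)).
Proof.
apply: eq_integrable (integrable_quadratic mu 0 b 0) => // y _ /=.
by rewrite quad0l add0r addr0.
Qed.

Lemma Rintegral_prob_cst mu (a : R) : \int[mu]_y a = a.
Proof. by rewrite Rintegral_cst// [X in fine X]probability_setT mulr1. Qed.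

Lemma Rintegral_dot mu b : \int[mu]_y dot b y = dot b (mean mu).
Proof.
rewrite /Rintegral.
under eq_integral do rewrite dotE -sumEFin.
rewrite integral_sum//=; last first.
  by move=> i; exact: integrableZl (integrable_coord mu i).
rewrite dotE -sum_fine.
  apply: eq_bigr => i _; rewrite mxE.
  under eq_integral do rewrite EFinM.
  rewrite integralZl//; last exact: integrable_coord.
  rewrite fineM//; apply: integrable_fin_num => //; exact: integrable_coord.
move=> i _; under eq_integral do rewrite EFinM.
apply: integrable_fin_num => //; exact: integrableZl (integrable_coord mu i).
Qed.

Lemma Rintegral_quadratic mu M b c :
  \int[mu]_y (quad M y + dot b y + c) =
  \int[mu]_y quad M y + dot b (mean mu) + c.
Proof.
have hqd : (P2_law mu).-integrable [set: borelRn R n]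
    (EFin \o (fun y : 'cV[R]_n => quad M y + dot b y)).
  by apply: eq_integrable (integrable_quadratic mu M b 0) => // y _ /=; rewrite addr0.
rewrite RintegralD//; last exact: integrable_cst.
rewrite RintegralD//; [|exact: integrable_quad|exact: integrable_dotl].
by rewrite Rintegral_dot Rintegral_prob_cst.
Qed.

End Moments.

(** * Mixtures and Dirac masses *)

Section MixDirac.
Context (R : realType) (n : nat).
Implicit Types (mu nu : P2 R n) (x y b : 'cV[R]_n) (M N : 'M[R]_n).

Lemma Rintegral_quadD mu M N :
  \int[mu]_y quad (M + N) y = \int[mu]_y quad M y + \int[mu]_y quad N y.
Proof.
rewrite -RintegralD//; [|exact: integrable_quad|exact: integrable_quad].
by apply: eq_Rintegral => y _; rewrite quadDl.
Qed.

Lemma Rintegral_quadZ mu a M :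
  \int[mu]_y quad (a *: M) y = a * \int[mu]_y quad M y.
Proof.
rewrite -RintegralZl//; last exact: integrable_quad.
by apply: eq_Rintegral => y _; rewrite quadZl.
Qed.

Lemma Rintegral_quadN mu M :
  \int[mu]_y quad (- M) y = - \int[mu]_y quad M y.
Proof. by rewrite -scaleN1r Rintegral_quadZ mulN1r. Qed.

Lemma Rintegral_quad0 mu : \int[mu]_y quad (0 : 'M[R]_n) y = 0.
Proof. by rewrite -(scale0r 0) Rintegral_quadZ mul0r. Qed.

Lemma Rintegral_mix mu nu (e : R) (f : 'cV[R]_n -> R) : 0 <= e <= 1 ->
  (P2_law mu).-integrable [set: borelRn R n] (EFin \o f) ->
  (P2_law nu).-integrable [set: borelRn R n] (EFin \o f) ->
  \int[mix mu nu e]_y f y = \int[mu]_y f y + e * (\int[nu]_y f y - \int[mu]_y f y).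
Proof.
move=> /andP[e0 e1] fmu fnu; have mf := measurable_int _ fmu.
have ce : clamp e = e by rewrite /clamp min_l// max_r.
(* For nonnegative functions the integral against the mixture splits even if values are infinite.
   Integrability then makes the four integrals of positive and negative parts finite, and real
   arithmetic concludes. *)
have mixE (g : borelRn R n -> \bar R) : measurable_fun setT g ->
    (forall y, 0 <= g y)%E ->
    (\int[mix mu nu e]_y g y =
     (1 - e)%:E * \int[mu]_y g y + e%:E * \int[nu]_y g y)%E.
  move=> mg g0; rewrite /= ge0_integral_measure_add//.
  by rewrite !ge0_integral_mscale//= ce.
rewrite /Rintegral.
rewrite [X in fine X = _]integralE mixE//; last exact: measurable_funepos.
rewrite mixE//; last exact: measurable_funeneg.
rewrite [X in _ = fine X + _]integralE [X in _ * (fine X - _)]integralE.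
rewrite [X in _ - fine X]integralE.
have := integrable_pos_fin_num measurableT fmu.
have := integrable_pos_fin_num measurableT fnu.
have := integrable_neg_fin_num measurableT fmu.
have := integrable_neg_fin_num measurableT fnu.
move=> /fineK <- /fineK <- /fineK <- /fineK <- /=.
ring.
Qed.

Lemma mean_mix mu nu (e : R) : 0 <= e <= 1 ->
  mean (mix mu nu e) = mean mu + e *: (mean nu - mean mu).
Proof.
move=> e01; apply/colP => i; rewrite !mxE.
by rewrite Rintegral_mix//; exact: integrable_coord.
Qed.

Lemma dirac_moment x :
  (\int[\d_(x : borelRn R n)]_y (dot (y : 'cV[R]_n) y)%:E < +oo)%E.
Proof.
rewrite integral_dirac//; last by apply/measurable_EFinP; exact: measurable_dot.
by rewrite diracT mul1e ltry.
Qed.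

Definition diracP2 x : P2 R n :=
  MkP2 (P2_law := (\d_(x : borelRn R n) : probability _ R)) (dirac_moment x).

Lemma Rintegral_diracP2 x (f : 'cV[R]_n -> R) :
  measurable_fun [set: borelRn R n] (EFin \o f) ->
  \int[diracP2 x]_y f y = f x.
Proof.
by move=> mf; rewrite /Rintegral integral_dirac// diracT mul1e.
Qed.

Lemma Rintegral_quad_diracP2 x M : \int[diracP2 x]_y quad M y = quad M x.
Proof. by apply: Rintegral_diracP2; exact: measurable_int (integrable_quad (diracP2 x) M). Qed.

Lemma mean_diracP2 x : mean (diracP2 x) = x.
Proof.
apply/colP => i; rewrite mxE; apply: Rintegral_diracP2.
exact: measurable_int (integrable_coord (diracP2 x) i).
Qed.

End MixDirac.
(** * Derivatives of quadratic functions of a measure *)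

Section DeltaMoment.
Context (R : realType) (n : nat).
Implicit Types (mu nu : P2 R n) (x y b : 'cV[R]_n) (M N : 'M[R]_n).

Lemma delta_unique (F : P2 R n -> R) mu d : is_delta F mu d -> delta F mu = d.
Proof.
move=> Fd; apply: xget_unique => // d' Fd'; apply/funext => y.
case: Fd => dI d0 dlim; case: Fd' => d'I d'0 d'lim.
have mE (g : 'cV[R]_n -> R) : (diracP2 y).-integrable [set: borelRn R n] (EFin \o g) ->
    \int[diracP2 y]_z g z = g y.
  by move=> gI; apply: Rintegral_diracP2; exact: measurable_int gI.
have := cvg_unique (@Rhausdorff R) (dlim (diracP2 y)) (d'lim (diracP2 y)).
by rewrite d0 d'0 !subr0 !mE// => ->.
Qed.

(** Along [mix mu nu e] both the second-moment integral and the mean are affine in [e], so [F] is a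
    polynomial of degree two in [e] and its linear coefficient is read off. The subtracted constant
    is the normalisation against [mu]. *)
Lemma delta_moment (F : P2 R n -> R) M N b c mu :
  (forall m, F m = \int[m]_y quad M y + quad N (mean m) + dot b (mean m) + c) ->
  delta F mu = fun y =>
    quad M y + dot ((N + N^T) *m mean mu + b) y
    - (\int[mu]_z quad M z + dot ((N + N^T) *m mean mu + b) (mean mu)).
Proof.
move=> FE; set w := (N + N^T) *m mean mu + b; apply: delta_unique; split.
- by move=> nu; exact: integrable_quadratic.
- by rewrite Rintegral_quadratic subrr.
move=> nu; rewrite !Rintegral_quadratic subrr subr0.
set q := quad N (mean nu - mean mu).
set l := (X in _ --> X).
apply: (@cvg_trans _ ((fun e : R => l + e * q) @ 0^'+)).
  (* For [0 < e <= 1], where the clamp is inactive, the quotient equals [l + e * q] exactly. *)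
  apply: near_eq_cvg; near=> e.
  have e0 : 0 < e by near: e; exact: nbhs_right_gt.
  have e1 : 0 <= e <= 1 by rewrite ltW//=; near: e; exact: nbhs_right_le.
  rewrite !FE Rintegral_mix//; [|exact: integrable_quad..].
  rewrite mean_mix// quadD quadZ /l /q !(dotDr, dotZr, dotNr) /w !dotDl.
  by field; rewrite gt_eqF.
suff : (l + e * q) @[e --> 0^'+] --> l + 0 * q by rewrite mul0r addr0.
apply: cvg_at_right_filter; apply: cvgD; first exact: cvg_cst.
by apply: cvgM; [exact: cvg_id|exact: cvg_cst].
Unshelve. all: by end_near. Qed.

End DeltaMoment.

Section QuadraticDerivatives.
Context (R : realType) (n : nat).
Implicit Types (x y b : 'cV[R]_n) (M N : 'M[R]_n).

Lemma pderiv_quadratic (f : 'cV[R]_n -> R) M b c i x :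
  (forall y, f y = quad M y + dot b y + c) ->
  pderiv i f x = ((M + M^T) *m x + b) i 0.
Proof.
move=> fE; rewrite /pderiv /derive; set v : 'cV[R]_n := delta_mx i 0.
set l := RHS; apply: cvg_lim; first exact: Rhausdorff.
apply: (@cvg_trans _ ((fun h : R => l + h * quad M v) @ 0^')).
  apply: near_eq_cvg; near=> h.
  have h0 : h != 0 by near: h; exact: nbhs_dnbhs_neq.
  rewrite /= !fE [h *: v + x]addrC quadD quadZ dotDr !dotZr.
  rewrite /l -dot_delta -/v dotDr (dotC v b) (dotC v) /GRing.scale/=.
  by field.
suff : (l + h * quad M v) @[h --> 0^'] --> l + 0 * quad M v by rewrite mul0r addr0.
apply: cvg_within_filter; apply: cvgD; first exact: cvg_cst.
by apply: cvgM; [exact: cvg_id|exact: cvg_cst].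
Unshelve. all: by end_near. Qed.

Lemma grad_quadratic (f : 'cV[R]_n -> R) M b c x :
  (forall y, f y = quad M y + dot b y + c) ->
  grad f x = ((M + M^T) *m x + b)^T.
Proof.
by move=> fE; apply/rowP => i; rewrite [LHS]mxE [RHS]mxE; exact: pderiv_quadratic fE.
Qed.

Lemma pderiv_affine (M : 'M[R]_n) b i j x :
  pderiv i (fun y => (M *m y + b) j 0) x = M j i.
Proof.
rewrite (@pderiv_quadratic _ 0 ((row j M)^T) (b j 0)); last first.
  by move=> y; rewrite quad0l add0r mxE /dot trmxK -row_mul [in RHS]mxE.
by rewrite trmx0 addr0 mul0mx add0r !mxE.
Qed.

Lemma hess_quadratic (f : 'cV[R]_n -> R) M b c x :
  (forall y, f y = quad M y + dot b y + c) -> hess f x = M + M^T.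
Proof.
move=> fE; apply/matrixP => i j; rewrite [LHS]mxE.
have -> : pderiv j f = fun y => ((M + M^T) *m y + b) j 0.
  by apply/funext => y; exact: pderiv_quadratic fE.
by rewrite pderiv_affine !mxE addrC.
Qed.

(** The inner derivative in [y'] removes [c x'] whatever its dependence on [x']. The normalising
    constant of [delta] is such a term. *)
Lemma mixed_quadratic (f : 'cV[R]_n -> 'cV[R]_n -> R) M N b c x y :
  (forall x' y', f x' y' = quad M y' + dot (N *m x' + b) y' + c x') ->
  mixed f x y = N^T.
Proof.
move=> fE; apply/matrixP => i j; rewrite !mxE.
have -> : (fun x' => pderiv j (f x') y) =
    fun x' => (N *m x' + ((M + M^T) *m y + b)) j 0.
  apply/funext => x'; rewrite (pderiv_quadratic _ _ (fE x')).
  by rewrite addrCA.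
exact: pderiv_affine.
Qed.

End QuadraticDerivatives.
(** * Differential equations on [0, T] *)

Section QuotOn.
Context (R : realType) (T : R).

(** Limits of difference quotients are unique because [t] is an accumulation point of [[0, T]]:
    nearby points lie to its right, or to its left when [t = T]. *)
Lemma within_itv_dnbhs_proper (t : R) : 0 < T -> 0 <= t <= T ->
  ProperFilter (within `[0, T] t^').
Proof.
move=> T0 /andP[t0 tT]; apply: Build_ProperFilter_ex.
move=> A /nbhs_ballP[e /= e0 eA].
have [tT'|Tt] := ltP t T.
- pose d := Num.min (e / 2) (T - t).
  have d0 : 0 < d by rewrite lt_min divr_gt0//= subr_gt0.
  exists (t + d); apply: eA.
  + rewrite /ball/= opprD addNKr normrN gtr0_norm// (@le_lt_trans _ _ (e / 2))//.
      by rewrite ge_min lexx.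
    by rewrite ltr_pdivrMr// ltr_pMr// ltr1n.
  + by rewrite /= -subr_eq0 addrAC subrr add0r gt_eqF.
  + rewrite /= in_itv/= addr_ge0//=; last exact: ltW.
    by rewrite -lerBrDl ge_min lexx orbT.
- have tE : t = T by apply/eqP; rewrite eq_le tT.
  pose d := Num.min (e / 2) T.
  have d0 : 0 < d by rewrite lt_min divr_gt0//= .
  exists (t - d); apply: eA.
  + rewrite /ball/= opprB addrCA subrr addr0 gtr0_norm// (@le_lt_trans _ _ (e / 2))//.
      by rewrite ge_min lexx.
    by rewrite ltr_pdivrMr// ltr_pMr// ltr1n.
  + by rewrite /= -subr_eq0 addrAC subrr add0r oppr_eq0 gt_eqF.
  + rewrite /= in_itv/= tE lerBlDr lerDl (ltW d0) andbT subr_ge0.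
    by rewrite ge_min lexx orbT.
Qed.

Section NormedCodomain.
Context (W : normedModType R).
Implicit Types (f g : R -> W) (t : R) (a b : W).

Lemma quot_on_eq f g t a : 0 <= t <= T ->
  (forall s, 0 <= s <= T -> f s = g s) ->
  quot_on T f t --> a -> quot_on T g t --> a.
Proof.
move=> tT fg; apply: cvg_trans; apply: near_eq_cvg; rewrite near_withinE.
by near=> s => sT; rewrite fg// fg//; move: sT; rewrite /= in_itv/=.
Unshelve. all: by end_near. Qed.

Lemma quot_on_cst a t : quot_on T (fun=> a) t --> (0 : W).
Proof.
rewrite /quot_on (_ : (fun s => _) = fun=> 0); first exact: cvg_cst.
by apply/funext => s; rewrite subrr scaler0.
Qed.

Lemma quot_onD f g t a b : quot_on T f t --> a -> quot_on T g t --> b ->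
  quot_on T (fun s => f s + g s) t --> a + b.
Proof.
move=> fa gb;
rewrite /quot_on (_ : (fun s => _) = fun s =>
  (s - t)^-1 *: (f s - f t) + (s - t)^-1 *: (g s - g t)); last first.
  by apply/funext => s; rewrite -scalerDr opprD addrACA.
exact: cvgD fa gb.
Qed.

Lemma quot_onZl (k : R) f t a : quot_on T f t --> a ->
  quot_on T (fun s => k *: f s) t --> k *: a.
Proof.
move=> fa;
rewrite /quot_on (_ : (fun s => _) = fun s =>
  k *: ((s - t)^-1 *: (f s - f t))); last first.
  by apply/funext => s; rewrite -scalerBr !scalerA mulrC.
by apply: cvgZ => //; exact: cvg_cst.
Qed.

Lemma quot_onN f t a : quot_on T f t --> a ->
  quot_on T (fun s => - f s) t --> - a.
Proof.
move=> fa; rewrite -scaleN1r.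
rewrite (_ : (fun s => - f s) = fun s => -1 *: f s); first exact: quot_onZl.
by apply/funext => s; rewrite scaleN1r.
Qed.

Lemma quot_onZr (k : R -> R) t (l : R) a : quot_on T k t --> l ->
  quot_on T (fun s => k s *: a) t --> l *: a.
Proof.
move=> kl;
rewrite /quot_on (_ : (fun s => _) = fun s =>
  ((s - t)^-1 *: (k s - k t)) *: a); last first.
  by apply/funext => s; rewrite -scalerBl scalerA.
by apply: cvgZ => //; exact: cvg_cst.
Qed.

Lemma quot_on_sum (I : Type) (r : seq I) (f : I -> R -> W) t (a : I -> W) :
  (forall i, quot_on T (f i) t --> a i) ->
  quot_on T (fun s => \sum_(i <- r) f i s) t --> \sum_(i <- r) a i.
Proof.
move=> fa; elim: r => [|i r IH].
  rewrite big_nil; under [X in quot_on _ X _]eq_fun do rewrite big_nil.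
  exact: quot_on_cst.
rewrite big_cons; under [X in quot_on _ X _]eq_fun do rewrite big_cons.
exact: quot_onD.
Qed.

Lemma deriv_onE f t a : 0 < T -> 0 <= t <= T ->
  quot_on T f t --> a -> deriv_on T f t = a.
Proof.
move=> T0 tT fa; have PF := within_itv_dnbhs_proper T0 tT.
by apply: (cvg_lim (@norm_hausdorff _ W)); exact: fa.
Qed.

End NormedCodomain.

Lemma quot_on_cvg (f : R -> R) (t a : R) : quot_on T f t --> a ->
  f @ within `[0, T] t^' --> f t.
Proof.
move=> fa.
have st : (fun s => s - t) @ within `[0, T] t^' --> (0 : R).
  apply: cvg_within_filter; apply: cvg_within_filter.
  suff : (s - t) @[s --> t] --> t - t by rewrite subrr.
  by apply: cvgB; [exact: cvg_id|exact: cvg_cst].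
have : (fun s => (s - t) * ((s - t)^-1 *: (f s - f t)) + f t) @ within `[0, T] t^'
    --> 0 * a + f t.
  by apply: cvgD; [exact: cvgM|exact: cvg_cst].
rewrite mul0r add0r; apply: cvg_trans; apply: near_eq_cvg; rewrite near_withinE.
near=> s => _; have s0 : s - t != 0.
  by rewrite subr_eq0; near: s; exact: nbhs_dnbhs_neq.
by rewrite /GRing.scale/= mulrA divff// mul1r subrK.
Unshelve. all: by end_near. Qed.

Lemma quot_onM (f g : R -> R) (t a b : R) : quot_on T f t --> a -> quot_on T g t --> b ->
  quot_on T (fun s => f s * g s) t --> a * g t + f t * b.
Proof.
move=> fa gb; rewrite /quot_on (_ : (fun s => _) = fun s =>
  ((s - t)^-1 *: (f s - f t)) * g s + f t * ((s - t)^-1 *: (g s - g t))); last first.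
  by apply/funext => s; rewrite /GRing.scale/=; ring.
apply: cvgD; first exact: cvgM fa (quot_on_cvg gb).
by apply: cvgM gb; exact: cvg_cst.
Qed.

Lemma quot_on_coord m k (Z : R -> 'M[R]_(m, k)) t (l : 'M[R]_(m, k)) i j :
  quot_on T Z t --> l -> quot_on T (fun s => Z s i j) t --> l i j.
Proof.
move=> Zl; rewrite /quot_on (_ : (fun s => _) = fun s =>
  ((s - t)^-1 *: (Z s - Z t)) i j); last first.
  by apply/funext => s; rewrite !mxE.
exact: (cvg_comp _ _ Zl (@coord_continuous _ m k i j l)).
Qed.

Lemma quot_on_mx m k (Z : R -> 'M[R]_(m, k)) t (l : 'M[R]_(m, k)) :
  (forall i j, quot_on T (fun s => Z s i j) t --> l i j) -> quot_on T Z t --> l.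
Proof.
move=> Zl; rewrite [l]matrix_sum_delta.
under [X in quot_on _ X _]eq_fun do rewrite [Z _]matrix_sum_delta.
apply: quot_on_sum => i; apply: quot_on_sum => j.
exact: quot_onZr.
Qed.

(** In finite dimension a linear functional is a combination of the entries, so entrywise limits
    suffice. This covers [fun M => \int[mu]_y quad M y]. *)
Lemma quot_on_linear m k (L : 'M[R]_(m, k) -> R) (Z : R -> 'M[R]_(m, k)) t l :
  linear L -> quot_on T Z t --> l -> quot_on T (L \o Z) t --> L l.
Proof.
move=> Llin Zl.
have LD u v : L (u + v) = L u + L v by have := Llin 1 u v; rewrite !scale1r.
have L0 : L 0 = 0.
  by have := LD 0 0; rewrite addr0 => /eqP; rewrite -subr_eq0 opprD addNKr oppr_eq0 => /eqP.
have LZ a u : L (a *: u) = a *: L u by have := Llin a u 0; rewrite !addr0 L0 addr0.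
have LE u : L u = \sum_i \sum_j u i j *: L (delta_mx i j).
  rewrite {1}[u]matrix_sum_delta (big_morph L LD L0); apply: eq_bigr => i _.
  by rewrite (big_morph L LD L0); apply: eq_bigr => j _; exact: LZ.
rewrite LE; under [X in quot_on _ X _]eq_fun do rewrite /comp LE.
apply: quot_on_sum => i; apply: quot_on_sum => j.
by apply: quot_onZr; exact: quot_on_coord.
Qed.

End QuotOn.

(** * Gronwall's inequality and linear matrix equations *)

Section Gronwall.
Context (R : realType) (T : R).

(** An interior point has a whole neighbourhood inside [[0, T]], so the restriction to the interval
    disappears from the filter. *)
Lemma quot_on_is_derive (f : R -> R) (t a : R) : 0 < t < T ->
  quot_on T f t --> a -> is_derive t 1 f a.
Proof.
move=> /andP[t0 tT] fa.
have fE : (fun h : R => h^-1 *: ((f \o shift t) (h *: 1) - f t)) @ 0^' --> a.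
  rewrite (_ : (fun h => _) = (fun s => (s - t)^-1 *: (f s - f t)) \o shift t).
    apply: cvg_comp fa => A tA.
    have shift0 : shift t @ (0 : R) --> t.
      suff : (h + t) @[h --> (0 : R)] --> 0 + t by rewrite add0r.
      by apply: cvgD; [exact: cvg_id|exact: cvg_cst].
    have tA' : \forall s \near t, s != t -> s \in `[0, T]%R -> A s by exact: tA.
    have tI : \forall s \near t, s \in `]0, T[%R.
      by apply: near_in_itvoo; rewrite in_itv/= t0.
    have tAI : \forall h \near (0 : R), h != 0 -> A (h + t).
      have [tA0 tI0] : (\forall h \near (0 : R), h + t != t -> h + t \in `[0, T]%R -> A (h + t))
          /\ \forall h \near (0 : R), h + t \in `]0, T[%R.
        by split; [exact: (shift0 _ tA')|exact: (shift0 _ tI)].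
      apply: filterS2 tA0 tI0 => h Ah; rewrite !in_itv/= => /andP[h0 hT] hn0.
      apply: Ah; first by rewrite -subr_eq0 addrK.
      by rewrite in_itv/= !ltW.
    exact: tAI.
  by apply/funext => h /=; rewrite addrK [h *: 1]mulr1.
split; first by apply: (cvgP a); exact: fE.
by apply: cvg_lim; [exact: Rhausdorff|exact: fE].
Qed.

Lemma ode_on_continuous (f v : R -> R) : ode_on T f v ->
  {within `[0, T], continuous f}.
Proof.
move=> fv; apply/subspace_continuousP => t /=; rewrite in_itv/= => tT.
have /= ft := quot_on_cvg (fv t tT).
move=> A fA.
have fA' : \forall s \near t, s != t -> s \in `[0, T]%R -> A (f s) by exact: (ft A fA).
suff : \forall s \near t, s \in `[0, T]%R -> A (f s) by [].
apply: filterS fA' => s sA sT.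
have [->|] := eqVneq s t; first exact: nbhs_singleton.
by move=> st; exact: sA.
Qed.

Lemma ode_on_bounded (f v : R -> R) : 0 < T -> ode_on T f v ->
  exists B, forall t, 0 <= t <= T -> `|f t| <= B.
Proof.
move=> T0 /ode_on_continuous fc.
have [c _ cmax] := EVT_max (ltW T0) fc; have [d _ dmin] := EVT_min (ltW T0) fc.
exists (Num.max (f c) (- f d)) => t tT; have tI : t \in `[0, T]%R by rewrite in_itv.
by rewrite ler_norml lerNl !le_max lerN2 cmax// dmin// orbT.
Qed.

(** Gronwall run backwards from [T]: [expR (C * t) * z t] has a nonnegative derivative, so it is at
    most its terminal value, which is zero. *)
Lemma gronwall_le0 (z v : R -> R) (C : R) : 0 < T -> ode_on T z v ->
  (forall t, 0 <= t <= T -> - (C * z t) <= v t) -> z T = 0 ->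
  forall t, 0 <= t <= T -> z t <= 0.
Proof.
move=> T0 zv vC zT t /andP[t0 tT].
have expC (s : R) : is_derive s 1 (fun s : R => expR (C * s)) (C * expR (C * s)).
  have sC : is_derive s 1 ( *:%R C : R -> R) C.
    have := @is_deriveZ _ _ _ id C s 1 1 (is_derive_id s 1).
    by rewrite /GRing.scale/= mulr1.
  have := @is_derive1_comp _ expR ( *:%R C) s _ _ (is_derive_expR _) sC.
  by rewrite mulrC.
have zc := ode_on_continuous zv.
suff : expR (C * t) * z t <= expR (C * T) * z T.
  by rewrite zT mulr0 pmulr_rle0// expR_gt0.
have gD (s : R) : s \in `]0, T[%R ->
    is_derive s 1 (fun s => expR (C * s) * z s) (expR (C * s) * (v s + C * z s)).
  rewrite in_itv/= => sT.
  have zs : is_derive s 1 z (v s).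
    by apply: quot_on_is_derive => //; apply: zv; case/andP: sT => *; rewrite !ltW.
  apply: (is_derive_eq (is_deriveM (expC s) zs)).
  by rewrite /GRing.scale/=; ring.
apply: (@ger0_derive1_ndecr _ (fun s => expR (C * s) * z s) 0 T) => //.
- by move=> s /gD [].
- move=> s sT; have [_ dE] := gD s sT; rewrite derive1E dE mulr_ge0 ?expR_ge0//.
  have sT' : 0 <= s <= T by move: sT; rewrite in_itv/= => /andP[? ?]; rewrite !ltW.
  by have := vC s sT'; lra.
- move=> s; apply: cvgM; last exact: zc.
  apply: continuous_subspaceT => r; apply: differentiable_continuous.
  by apply/derivable1_diffP; have [] := expC r.
Qed.

Definition mx_bounded m k (F : R -> 'M[R]_(m, k)) : Prop :=
  exists B, forall t i j, 0 <= t <= T -> `|F t i j| <= B.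

Lemma mx_bounded_cst m k (M : 'M[R]_(m, k)) : mx_bounded (fun=> M).
Proof.
exists (\sum_i \sum_j `|M i j|) => t i j _.
rewrite (bigD1 i)//= (bigD1 j)//= -addrA lerDl addr_ge0//.
  by apply: sumr_ge0.
by apply: sumr_ge0 => i' _; apply: sumr_ge0.
Qed.

Lemma mx_boundedD m k (F G : R -> 'M[R]_(m, k)) :
  mx_bounded F -> mx_bounded G -> mx_bounded (fun t => F t + G t).
Proof.
move=> [B FB] [C GC]; exists (B + C) => t i j tT; rewrite mxE.
by rewrite (le_trans (ler_normD _ _))// lerD// ?FB// GC.
Qed.

Lemma mx_boundedN m k (F : R -> 'M[R]_(m, k)) :
  mx_bounded F -> mx_bounded (fun t => - F t).
Proof. by move=> [B FB]; exists B => t i j tT; rewrite mxE normrN FB. Qed.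

Lemma mx_bounded_tr m k (F : R -> 'M[R]_(m, k)) :
  mx_bounded F -> mx_bounded (fun t => (F t)^T).
Proof. by move=> [B FB]; exists B => t i j tT; rewrite mxE FB. Qed.

Lemma mx_boundedM m k l (F : R -> 'M[R]_(m, k)) (G : R -> 'M[R]_(k, l)) :
  mx_bounded F -> mx_bounded G -> mx_bounded (fun t => F t *m G t).
Proof.
move=> [B FB] [C GC]; exists (\sum_(i < k) B * C) => t i j tT; rewrite mxE.
rewrite (le_trans (ler_norm_sum _ _ _))// ler_sum// => h _.
by rewrite normrM ler_pM// ?FB ?GC.
Qed.

Lemma ode_on_mx_bounded m k (F v : R -> 'M[R]_(m, k)) : 0 < T ->
  ode_on T F v -> mx_bounded F.
Proof.
move=> T0 Fv.
have /choice[B FB] (ij : 'I_m * 'I_k) : exists B, forall t, 0 <= t <= T ->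
    `|F t ij.1 ij.2| <= B.
  apply: (@ode_on_bounded _ (fun t => v t ij.1 ij.2)) => // t tT.
  exact: quot_on_coord (Fv t tT).
exists (\sum_ij `|B ij|) => t i j tT.
rewrite (le_trans (FB (i, j) t tT))// (le_trans (ler_norm _))//.
by rewrite (bigD1 (i, j))//= lerDl sumr_ge0.
Qed.

(* Gronwall's inequality for the squared Frobenius norm of [Z]. *)
Lemma linear_ode_eq0 m k (Z : R -> 'M[R]_(m, k)) (F : R -> 'M[R]_m)
    (G : R -> 'M[R]_k) : 0 < T -> mx_bounded F -> mx_bounded G ->
  ode_on T Z (fun t => F t *m Z t + Z t *m G t) -> Z T = 0 ->
  forall t, 0 <= t <= T -> Z t = 0.
Proof.
move=> T0 [B FB] [C GC] Zode ZT.
pose z t := \sum_i \sum_j Z t i j * Z t i j.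
pose v t := \sum_i \sum_j ((F t *m Z t + Z t *m G t) i j * Z t i j +
                           Z t i j * (F t *m Z t + Z t *m G t) i j).
have zv : ode_on T z v.
  move=> t tT; apply: quot_on_sum => i; apply: quot_on_sum => j.
  by apply: quot_onM; exact: quot_on_coord (Zode t tT).
have z0 : z T = 0.
  by rewrite /z ZT big1// => i _; rewrite big1// => j _; rewrite mxE mulr0.
have zle t i j : Z t i j * Z t i j <= z t.
  rewrite /z (bigD1 i)//= (bigD1 j)//= -addrA lerDl addr_ge0//.
    by apply: sumr_ge0 => ? _; rewrite -expr2 sqr_ge0.
  by apply: sumr_ge0 => ? _; apply: sumr_ge0 => ? _; rewrite -expr2 sqr_ge0.
(* Used with [p], [q] entries of [Z t] and [w = z t]: [|p q| <= (p^2 + q^2) / 2 <= w]. *)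
have prod_le (c B' p q w : R) : `|c| <= B' -> p * p <= w -> q * q <= w ->
    - (B' * w) <= c * (p * q).
  move=> cB pw qw; rewrite lerNl -mulrN.
  apply: (le_trans (ler_norm _)); rewrite normrM normrN.
  apply: ler_pM => //; rewrite normrM.
  have := sqr_ge0 (`|p| - `|q|).
  have : `|p| * `|p| <= w by rewrite -normrM ger0_norm// -expr2 sqr_ge0.
  have : `|q| * `|q| <= w by rewrite -normrM ger0_norm// -expr2 sqr_ge0.
  by nra.
(* Each entry of [Z] contributes two equal products, by the product rule. Each of these expands into
   [m] terms bounded by [B * z t], from [F], and [k] terms bounded by [C * z t], from [G]. *)
pose K := \sum_(i < m) \sum_(j < k) (2 * (\sum_(l < m) B + \sum_(l < k) C)).
have vK t : 0 <= t <= T -> - (K * z t) <= v t.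
  move=> tT; rewrite /K /v mulr_suml -sumrN; apply: ler_sum => i _.
  rewrite mulr_suml -sumrN; apply: ler_sum => j _.
  set BC := (\sum_(l < m) B + _); set Mij := (F t *m Z t + _) i j.
  suff : - (BC * z t) <= Mij * Z t i j by rewrite -mulrA [Z t i j * _]mulrC; lra.
  rewrite /BC /Mij mulrDl !mxE opprD mulrDl lerD//.
    rewrite !mulr_suml -sumrN; apply: ler_sum => l _; rewrite -mulrA.
    by apply: prod_le; [exact: FB|exact: zle..].
  rewrite !mulr_suml -sumrN; apply: ler_sum => l _.
  rewrite [X in _ <= X * _]mulrC -mulrA.
  by apply: prod_le; [exact: GC|exact: zle..].
move=> t tT; apply/matrixP => i j; rewrite mxE.
have zt0 := gronwall_le0 T0 zv vK z0 tT.
apply/eqP; rewrite -sqrf_eq0 eq_le sqr_ge0 andbT expr2.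
exact: le_trans (zle t i j) zt0.
Qed.

End Gronwall.
(** * Quadratic forms in (x, mu) *)

Section QForm.
Context (R : realType) (n : nat).
Implicit Types (mu : P2 R n) (x y b : 'cV[R]_n) (M N : 'M[R]_n).

(** This is [quadratic_fun] at a frozen time. The same form serves for [U], for its time derivative
    and for the whole right-hand side of the equation. *)
Definition qform (M1 M2 M3 M4 : 'M[R]_n) (s th : 'cV[R]_n) (r : R)
    (x : 'cV[R]_n) (mu : P2 R n) : R :=
  quad M1 x + \int[mu]_y quad M2 y + quad M3 (mean mu)
  + 2 * dot x (M4 *m mean mu) + 2 * dot x s + 2 * dot (mean mu) th + r.

Lemma qformD M1 M2 M3 M4 s th r N1 N2 N3 N4 s' th' r' x mu :
  qform (M1 + N1) (M2 + N2) (M3 + N3) (M4 + N4) (s + s') (th + th') (r + r') x mu =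
  qform M1 M2 M3 M4 s th r x mu + qform N1 N2 N3 N4 s' th' r' x mu.
Proof.
by rewrite /qform !quadDl Rintegral_quadD mulmxDl !dotDr; ring.
Qed.

Lemma qformN M1 M2 M3 M4 s th r x mu :
  qform (- M1) (- M2) (- M3) (- M4) (- s) (- th) (- r) x mu =
  - qform M1 M2 M3 M4 s th r x mu.
Proof.
by rewrite /qform !quadNl Rintegral_quadN mulNmx !dotNr; ring.
Qed.

(** Comparing [x] with [- x] separates the even part from the odd one. *)
Lemma affine_quad_eq0 M b : (forall x, quad M x + 2 * dot x b = 0) ->
  (forall x, quad M x = 0) /\ b = 0.
Proof.
move=> h; have b0 : b = 0.
  apply: dot_eq0 => x; have := h x; have := h (- x).
  by rewrite quadN dotNl; lra.
by split=> // x; have := h x; rewrite b0 dot0r mulr0 addr0.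
Qed.

(* Dirac masses decouple all coefficients but [M2] and [M3], which are told
   apart by the centred measures (delta_y + delta_{-y}) / 2. *)
Lemma qform_eq0 M1 M2 M3 M4 s th r :
  (forall x mu, qform M1 M2 M3 M4 s th r x mu = 0) ->
  [/\ [/\ M1 + M1^T = 0, M2 + M2^T = 0 & M3 + M3^T = 0],
      M4 = 0, s = 0, th = 0 & r = 0].
Proof.
move=> q0; pose half : R := 2^-1.
have half01 : 0 <= half <= 1 by rewrite /half; lra.
have q0d x y := q0 x (diracP2 y).
rewrite /qform in q0d; have {}q0d x y : quad M1 x + quad (M2 + M3) y
    + 2 * dot x (M4 *m y) + 2 * dot x s + 2 * dot y th + r = 0.
  by rewrite -(q0d x y) mean_diracP2 Rintegral_quad_diracP2 quadDl; ring.
have r0 : r = 0.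
  by rewrite -(q0d 0 0) !dot0l -(scale0r 0) !quadZ; ring.
have [M1q s0] : (forall x, quad M1 x = 0) /\ s = 0.
  apply: affine_quad_eq0 => x; have := q0d x 0.
  by rewrite mulmx0 dot0r dot0l r0 -(scale0r 0) quadZ => <-; ring.
have [M23q th0] : (forall x, quad (M2 + M3) x = 0) /\ th = 0.
  apply: affine_quad_eq0 => y; have := q0d 0 y.
  by rewrite !dot0l r0 -(scale0r 0) quadZ => <-; ring.
have M40 : M4 = 0.
  apply: bilin_eq0 => x y; have := q0d x y.
  by rewrite M1q M23q s0 th0 r0 !dot0r; lra.
have M2q y : quad M2 y = 0.
  have := q0 0 (mix (diracP2 y) (diracP2 (- y)) half); rewrite /qform mean_mix//.
  rewrite Rintegral_mix//; [|exact: integrable_quad..].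
  rewrite !mean_diracP2 !Rintegral_quad_diracP2 quadN subrr mulr0.
  have -> : y + half *: (- y - y) = 0.
    apply/colP => i; rewrite !mxE /half; lra.
  by rewrite !dot0l r0 -(scale0r 0) !quadZ => <-; ring.
have M3q y : quad M3 y = 0 by have := M23q y; rewrite quadDl M2q add0r.
by split=> //; split; exact: quad_eq0.
Qed.

Lemma qform_inj M1 M2 M3 M4 s th r N1 N2 N3 N4 s' th' r' :
  sym_mx M1 -> sym_mx M2 -> sym_mx M3 -> sym_mx N1 -> sym_mx N2 -> sym_mx N3 ->
  (forall x mu, qform M1 M2 M3 M4 s th r x mu = qform N1 N2 N3 N4 s' th' r' x mu) ->
  [/\ [/\ M1 = N1, M2 = N2 & M3 = N3], M4 = N4, s = s', th = th' & r = r'].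
Proof.
move=> M1s M2s M3s N1s N2s N3s q.
have sym_eq0 (M N : 'M[R]_n) : sym_mx M -> sym_mx N -> (M - N) + (M - N)^T = 0 -> M = N.
  move=> Ms Ns /matrixP MN; apply/matrixP => i j; have := MN i j.
  by rewrite linearB/= Ms Ns !mxE; lra.
have [|[m1 m2 m3] m4 hs hth hr] := @qform_eq0 (M1 - N1) (M2 - N2) (M3 - N3) (M4 - N4)
    (s - s') (th - th') (r - r').
  by move=> x mu; rewrite qformD qformN q subrr.
by split; [split; exact: sym_eq0|exact: subr0_eq..].
Qed.

End QForm.

(** * Transposes, products and the expanded cost *)

Section Normalisation.
Context (R : realType).

Lemma trmxD m k (M N : 'M[R]_(m, k)) : (M + N)^T = M^T + N^T.
Proof. exact: linearD. Qed.

Lemma trmxN m k (M : 'M[R]_(m, k)) : (- M)^T = - M^T.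
Proof. exact: linearN. Qed.

Lemma trmxZ m k a (M : 'M[R]_(m, k)) : (a *: M)^T = a *: M^T.
Proof. exact: linearZ. Qed.

Lemma mulmxZr m k l a (M : 'M[R]_(m, k)) (N : 'M[R]_(k, l)) :
  M *m (a *: N) = a *: (M *m N).
Proof. by rewrite scalemxAr. Qed.

Lemma mulmxZl m k l a (M : 'M[R]_(m, k)) (N : 'M[R]_(k, l)) :
  (a *: M) *m N = a *: (M *m N).
Proof. by rewrite scalemxAl. Qed.

Definition mx_expand := (trmxD, trmxN, trmxZ, trmx_mul, @trmxK,
  @mulmxDl, @mulmxDr, @mulNmx, @mulmxN, mulmxZr, mulmxZl, @mulmxA).

Definition dot_expand := (@dotDl, @dotDr, @dotNl, @dotNr, @dotZl, @dotZr, @dot_mull).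

Lemma trmx_congr n (M N : 'M[R]_n) : N^T = N -> (M^T *m N *m M)^T = M^T *m N *m M.
Proof. by move=> Ns; rewrite !trmx_mul trmxK Ns mulmxA. Qed.

(** Sorts the closed-loop running cost by powers of the mean [m], as [delta_moment] asks. With [K],
    [P], [Psi] and [s] zero it gives the terminal cost. *)
Lemma feedback_cost_expand n (Q K P Psi Gam : 'M[R]_n) (y eta s m : 'cV[R]_n) :
  Q^T = Q -> K^T = K -> Psi^T = Psi -> P^T = P ->
  quad Q (y - Gam *m m - eta) + quad K (P *m y + Psi *m m + s) =
  quad (Gam^T *m Q *m Gam + Psi *m K *m Psi) m
  + dot (2 *: (Psi *m K *m (P *m y + s) - Gam^T *m Q *m (y - eta))) m
  + (quad Q (y - eta) + quad K (P *m y + s)).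
Proof.
move=> Qs Ks Psis Ps.
rewrite addrAC [P *m y + _ + s]addrAC !quadD quadN /quad !(mx_expand, dot_expand).
by rewrite Qs Ks Psis Ps; ring.
Qed.

End Normalisation.

(** * Spatial derivatives of [delta] and [delta2] *)

Section MomentDerivatives.
Context (R : realType) (n : nat).
Implicit Types (mu : P2 R n) (x y z b : 'cV[R]_n) (M N : 'M[R]_n).

Lemma grad_delta_moment (F : P2 R n -> R) M N b c mu y :
  (forall m, F m = \int[m]_y quad M y + quad N (mean m) + dot b (mean m) + c) ->
  grad (delta F mu) y = ((M + M^T) *m y + ((N + N^T) *m mean mu + b))^T.
Proof.
move=> FE; apply: grad_quadratic => z; rewrite (delta_moment _ FE); reflexivity.
Qed.

Lemma hess_delta_moment (F : P2 R n -> R) M N b c mu y :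
  (forall m, F m = \int[m]_y quad M y + quad N (mean m) + dot b (mean m) + c) ->
  hess (delta F mu) y = M + M^T.
Proof.
move=> FE; apply: hess_quadratic => z; rewrite (delta_moment _ FE); reflexivity.
Qed.

(** For fixed [y'] the functional [delta F m y'] is again of the form required by [delta_moment],
    with matrices [- M] and [- N2]. Its linear coefficient [N2 *m y' - b] is the only place where
    [y'] meets [z']. *)
Lemma mixed_delta2_moment (F : P2 R n -> R) M N b c mu y z :
  (forall m, F m = \int[m]_y quad M y + quad N (mean m) + dot b (mean m) + c) ->
  mixed (delta2 F mu) y z = N + N^T.
Proof.
move=> FE; pose N2 := N + N^T.
have N2t : N2^T = N2 by rewrite /N2 linearD/= trmxK addrC.
have dE y' : forall m, delta F m y' = \int[m]_y quad (- M) y + quad (- N2) (mean m)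
    + dot (N2 *m y' - b) (mean m) + (quad M y' + dot b y').
  move=> m; rewrite (delta_moment _ FE) -/N2 Rintegral_quadN quadNl /quad.
  by rewrite !dotDl !dotNl !dot_mull N2t [dot (mean m) (N2 *m y')]dot_flip N2t; ring.
rewrite (@mixed_quadratic _ _ _ (- M) N2 ((- N2 + (- N2)^T) *m mean mu - b) (fun y' =>
   - (\int[mu]_z quad (- M) z + dot ((- N2 + (- N2)^T) *m mean mu + (N2 *m y' - b)) (mean mu)))).
  by [].
move=> y' z'; rewrite /delta2 (delta_moment _ (dE y')).
by rewrite [(- N2 + _) *m _ + (_ + _)]addrCA.
Qed.

End MomentDerivatives.

(** * The master equation on quadratic functions *)

Section Closedloop.
Context (R : realType) (n n1 n2 n3 : nat) (lq : lq_data R n n1 n2 n3).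

Lemma pd_unitmx (k : nat) (M : 'M[R]_k) : pd M -> M \in unitmx.
Proof.
move=> [_ M0]; rewrite -row_free_unit -kermx_eq0; apply/negPn/negP => /rowV0Pn[v].
move=> /sub_kermxP vM v0; have := M0 v^T.
by rewrite trmx_eq0 /quad /dot trmxK mulmxA vM mul0mx mxE ltxx => /(_ v0).
Qed.

Lemma trmx_lqK : (lqK lq)^T = lqK lq.
Proof.
have [Rs _] := lqR_pd lq; rewrite /lqK !trmx_mul trmxK trmx_inv.
by rewrite [X in invmx X]Rs mulmxA.
Qed.

(** The control weight cancels against one of its two inverses, which leaves [K]. *)
Lemma quad_feedback (w : 'cV[R]_n) :
  quad (lqR lq) (- (invmx (lqR lq) *m (lqB lq)^T *m w)) = quad (lqK lq) w.
Proof.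
rewrite quadN /quad /lqK -!mulmxA mulKVmx ?pd_unitmx//; last exact: lqR_pd.
have [Rs _] := lqR_pd lq.
by rewrite !dot_mull trmx_inv [X in invmx X]Rs trmxK.
Qed.

Context (c : riccati_fun R n) (t : R).
Let P := rP c t.
Let Lam := rLam c t.
Let H := rH c t.
Let s := rS c t + rth c t.
Let K := lqK lq.
Let Q := lqQ lq.
Let Gam := lqGam lq.
Let eta := lqeta lq.
Let Gh := Ghat lq c t.

(* The optimal feedback is - R^-1 B^T (P x + mean_gain * mean mu + S + theta). *)
Definition mean_gain : 'M[R]_n := rLam c t + rH c t + (rH c t)^T.
Definition closed_loop : 'M[R]_n := lqA lq - lqK lq *m rP c t.
Let Psi := mean_gain.
Let E := closed_loop.

Lemma fstarE (x : 'cV[R]_n) (mu : P2 R n) :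
  fstar lq c t x mu = E *m x + Gh *m mean mu - K *m s.
Proof.
rewrite /fstar /drift /phi mulmxN !mulmxA -/(lqK lq) -/K !mulmxDr !mulmxA.
rewrite /E /closed_loop /Gh /Ghat !mulmxBl ?mulmxA -/K /s !mulmxDr -/Psi.
by apply/colP => i; rewrite !mxE; ring.
Qed.

Lemma LstarE (x : 'cV[R]_n) (mu : P2 R n) :
  Lstar lq c t x mu = quad Q (x - Gam *m mean mu - eta) + quad K (P *m x + Psi *m mean mu + s).
Proof. by rewrite /Lstar /run_cost /phi quad_feedback !addrA. Qed.

Hypotheses (Psym : sym_mx P) (Lsym : sym_mx Lam).

Lemma trmx_mean_gain : Psi^T = Psi.
Proof. by rewrite /Psi /mean_gain !linearD/= trmxK Lsym addrAC. Qed.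

Lemma trmx_lqQ : Q^T = Q.
Proof. by case: (lqQ_psd lq). Qed.

(** Averaging turns the cross term of [V] into [2 * quad H (mean mu)], the form of [H + H^T].
    Together with [Lam] this makes the gain [Psi] of the feedback appear, and the two linear terms
    merge into [s]. *)
Lemma UbarE (mu : P2 R n) : Ubar c t mu =
  \int[mu]_y quad P y + quad Psi (mean mu) + dot (2 *: s) (mean mu) + rr c t.
Proof.
rewrite /Ubar (_ : \int[mu]_y V c t y mu = \int[mu]_y (quad P y +
  dot (2 *: (H *m mean mu + rS c t)) y +
  (quad Lam (mean mu) + 2 * dot (mean mu) (rth c t) + rr c t))).
  rewrite Rintegral_quadratic /Psi /mean_gain !quadDl quad_tr /s !(dotZl, dotDl).
  rewrite [dot (rth c t) _]dotC [dot (H *m _) _]dotC -/(quad H _) -/Lam -/H.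
  by ring.
by apply: eq_Rintegral => y _; rewrite /V dotZl dotDl ![dot _ y]dotC -/P -/Lam -/H; ring.
Qed.

Lemma LstarE_moment (y : 'cV[R]_n) (mu : P2 R n) : Lstar lq c t y mu =
  \int[mu]_z quad (0 : 'M[R]_n) z + quad (Gam^T *m Q *m Gam + Psi *m K *m Psi) (mean mu)
  + dot (2 *: (Psi *m K *m (P *m y + s) - Gam^T *m Q *m (y - eta))) (mean mu)
  + (quad Q (y - eta) + quad K (P *m y + s)).
Proof.
rewrite LstarE Rintegral_quad0 add0r.
have [Qs _] := lqQ_psd lq.
by rewrite (feedback_cost_expand _ _ _ _ _ Qs trmx_lqK trmx_mean_gain Psym).
Qed.

(** The normalising constants cancel in the difference. The cost depends on [mu] through its mean
    only, so what remains is linear in [x - z]. *)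
Lemma delta_LstarE (y : 'cV[R]_n) (mu : P2 R n) (x z : 'cV[R]_n) :
  delta (Lstar lq c t y) mu x - delta (Lstar lq c t y) mu z =
  2 * dot ((Gam^T *m Q *m Gam + Psi *m K *m Psi) *m mean mu +
    (Psi *m K *m (P *m y + s) - Gam^T *m Q *m (y - eta))) (x - z).
Proof.
rewrite !(delta_moment _ (LstarE_moment y)) !quad0l.
set N := Gam^T *m Q *m Gam + _.
have -> : N^T = N.
  rewrite /N trmxD (trmx_congr _ trmx_lqQ).
  by rewrite -[in X in X *m K]trmx_mean_gain (trmx_congr _ trmx_lqK).
have -> : N + N = 2 *: N by rewrite scaler_nat mulr2n.
by rewrite -scalemxAl -scalerDr !dotZl dotDr dotNr; ring.
Qed.

Lemma delta_fstarE (y : 'cV[R]_n) (mu : P2 R n) (x z : 'cV[R]_n) :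
  delta_vec (fstar lq c t y) mu x - delta_vec (fstar lq c t y) mu z = Gh *m (x - z).
Proof.
apply/colP => i; rewrite mulmxBr !mxE.
have fE m : fstar lq c t y m i 0 = \int[m]_z quad (0 : 'M[R]_n) z + quad 0 (mean m)
    + dot (row i Gh)^T (mean m) + (E *m y - K *m s) i 0.
  by rewrite fstarE Rintegral_quad0 quad0l /dot trmxK -row_mul !mxE; ring.
rewrite !(delta_moment _ fE) !quad0l trmx0 addr0 mul0mx !add0r /dot trmxK -!row_mul !mxE.
by ring.
Qed.

End Closedloop.

(** * Collecting the terms of the master equation *)

Section MasterRhs.
Context (R : realType) (n : nat).
Implicit Types (mu : P2 R n) (x y b : 'cV[R]_n) (M N : 'M[R]_n).

Lemma Rintegral_dot_affine mu M N (a b : 'cV[R]_n) :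
  \int[mu]_y dot (M *m y + a) (N *m y + b) =
  \int[mu]_y quad (M^T *m N) y + dot (M^T *m b + N^T *m a) (mean mu) + dot a b.
Proof.
rewrite -Rintegral_quadratic; apply: eq_Rintegral => y _.
rewrite /quad !(dotDl, dotDr) !dot_mull !trmxK !mulmxA.
by rewrite [dot a (N *m y)]dotC dot_mull [dot b (M *m y)]dotC dot_mull; ring.
Qed.

Lemma Rintegral_prod_cst mu (a : R) : \int[(P2_law mu \x P2_law mu)%E]_yz a = a.
Proof.
rewrite Rintegral_cst// [X in fine X](_ : _ = 1%E) ?mulr1//.
have /= := product_measure1E (P2_law mu) (P2_law mu) measurableT measurableT.
by rewrite setXTT => ->; rewrite [X in (X * X)%E]probability_setT mule1.
Qed.

(** The left side lists the eleven terms of the equation in their order, already evaluated; the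
    right side sorts them by coefficient. The vectors [w], [g], [a] are the parts free of the
    integration variable in the gradient of [delta U], in [fstar], and in the linear coefficient of
    [delta Lstar]. *)
Lemma master_identity mu (d1 d2 d3 d4 p1 p2 p3 p4 E Gh K Q Gam P Psi Sig Sig0 : 'M[R]_n)
    (ds dth ps pth s eta x : 'cV[R]_n) (dr : R) :
  p1^T = p1 -> p2^T = p2 -> p3^T = p3 -> K^T = K -> Q^T = Q -> P^T = P -> Psi^T = Psi ->
  let m := mean mu in
  let w := 2 *: (p3 *m m + (p4^T *m x + pth)) in
  let g := Gh *m m - K *m s in
  let a := 2 *: ((Gam^T *m Q *m Gam + Psi *m K *m Psi) *m m
                 + (Psi *m K *m s + Gam^T *m Q *m eta)) in
  qform d1 d2 d3 d4 ds dth dr x mu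
  + dot (2 *: (p1 *m x + (p4 *m m + ps))) (E *m x + Gh *m m - K *m s)
  + 2^-1 * \tr ((p1 + p1^T) *m (Sig + Sig0))
  + (quad Q (x - Gam *m m - eta) + quad K (P *m x + Psi *m m + s))
  + (\int[mu]_y quad ((2 *: p2)^T *m E) y
     + dot ((2 *: p2)^T *m g + E^T *m w) m + dot w g)
  + 2^-1 * \tr ((p2 + p2^T) *m (Sig + Sig0))
  + \tr ((2 *: p4) *m Sig0)
  + 2^-1 * \tr ((p3 + p3^T) *m Sig0)
  + (\int[mu]_y quad ((2 *: (Psi *m K *m P - Gam^T *m Q))^T *m - 1%:M) y
     + dot ((2 *: (Psi *m K *m P - Gam^T *m Q))^T *m x + (- 1%:M)^T *m a) m + dot a x)
  + (\int[mu]_y quad ((2 *: P)^T *m - Gh) y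
     + dot ((2 *: P)^T *m (Gh *m x) + (- Gh)^T *m (2 *: (Psi *m m + s))) m
     + dot (2 *: (Psi *m m + s)) (Gh *m x))
  + 2^-1 * \tr ((Psi + Psi^T) *m Sig) =
  qform
    (d1 + 2 *: (p1 *m E) + Q + P *m K *m P)
    (d2 + 2 *: (p2 *m E) - 2 *: (P *m K *m Psi - Q *m Gam) - 2 *: (P *m Gh))
    (d3 + 2 *: (Gh^T *m p2) + 2 *: (p3 *m (E + Gh)) - Gam^T *m Q *m Gam
     - Psi *m K *m Psi + 2 *: (p4^T *m Gh) - 2 *: (Psi *m Gh))
    (d4 + p1 *m Gh + E^T *m p4 + p4 *m (E + Gh) - Q *m Gam + P *m K *m Psi
     + Gam^T *m Q *m Gam + Psi *m K *m Psi + Psi *m K *m P - Gam^T *m Q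
     + Gh^T *m (Psi + P))
    (ds - p1 *m K *m s + E^T *m ps - p4 *m K *m s - Q *m eta + P *m K *m s
     + Gam^T *m Q *m eta + Psi *m K *m s + Gh^T *m s)
    (dth + Gh^T *m ps + (E + Gh)^T *m pth - (p2 + p3 + p4^T) *m K *m s - Gh^T *m s)
    (dr - 2 * dot ps (K *m s) - 2 * dot pth (K *m s) + quad Q eta + quad K s
     + \tr ((p1 + p2) *m (Sig + Sig0)) + 2 * \tr (p4 *m Sig0)
     + \tr (p3 *m Sig0) + \tr (Psi *m Sig))
    x mu.
Proof.
move=> p1s p2s p3s Ks Qs Ps Psis m w g a; rewrite {}/w {}/g {}/a {}/m /qform.
(* The matrices under the integrals are brought to the shape of the summands on the right, so that
   the integrals match one by one and can be generalised to scalars. *)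
have -> : (2 *: p2)^T *m E = 2 *: (p2 *m E) by rewrite trmxZ p2s mulmxZl.
have -> : (2 *: P)^T *m - Gh = - (2 *: (P *m Gh)) by rewrite trmxZ Ps mulmxN mulmxZl.
have -> : (2 *: (Psi *m K *m P - Gam^T *m Q))^T *m - 1%:M =
    - (2 *: (P *m K *m Psi - Q *m Gam)).
  by rewrite mulmxN mulmx1 trmxZ trmxD trmxN !trmx_mul trmxK Ps Ks Psis Qs mulmxA.
rewrite 3!Rintegral_quadD.
move: (\int[mu]_y quad d2 y) (\int[mu]_y quad (2 *: (p2 *m E)) y) => i1 i2.
move: (\int[mu]_y quad _ y) (\int[mu]_y quad _ y) => i3 i4.
move: (mean mu) => m.
rewrite !trmxN trmx1 !mulNmx !mul1mx.
rewrite !(mulmxDl, mulmxDr, mxtraceD, mulmxZl, mxtraceZ).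
rewrite /quad !(mx_expand, dot_expand) ?(p1s, p2s, p3s, Ks, Qs, Ps, Psis).
(* Every bilinear term is oriented the same way, [x] first, then [m], then [ps] and [pth], then [s]
   and [eta], so that transposed copies of a term coincide. *)
rewrite !(dot_flip m x, dot_flip ps x, dot_flip pth x, dot_flip s x, dot_flip eta x,
  dot_flip ps m, dot_flip pth m, dot_flip s m, dot_flip eta m, dot_flip s ps, dot_flip s pth).
rewrite ?(trmx_mul, trmxK, p1s, p2s, p3s, Ks, Qs, Ps, Psis, mulmxA).
by field.
Qed.
End MasterRhs.
Section MasterQuadratic.
Context (R : realType) (n n1 n2 n3 : nat) (lq : lq_data R n n1 n2 n3).
Context (c : riccati_fun R n) (t T : R).
Hypotheses (Psym : sym_mx (rP c t)) (Lsym : sym_mx (rLam c t)).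

Variables (U : R -> 'cV[R]_n -> P2 R n -> R).
Variables (p1 p2 p3 p4 d1 d2 d3 d4 : 'M[R]_n) (ps pth ds dth : 'cV[R]_n) (pr dr : R).
Hypotheses (p1s : sym_mx p1) (p2s : sym_mx p2) (p3s : sym_mx p3).
Hypothesis UE : forall x mu, U t x mu = qform p1 p2 p3 p4 ps pth pr x mu.
Hypothesis dUE : forall x mu,
  deriv_on T (fun s => U s x mu) t = qform d1 d2 d3 d4 ds dth dr x mu.

Let P := rP c t.
Let s := rS c t + rth c t.
Let K := lqK lq.
Let Q := lqQ lq.
Let Gam := lqGam lq.
Let eta := lqeta lq.
Let Gh := Ghat lq c t.
Let Psi := mean_gain c t.
Let E := closed_loop lq c t.
Let S0 := Sig0 lq.

Let U_x mu x' : U t x' mu = quad p1 x' + dot (2 *: (p4 *m mean mu + ps)) x' +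
  (\int[mu]_y quad p2 y + quad p3 (mean mu) + 2 * dot (mean mu) pth + pr).
Proof.
by rewrite UE /qform dotZl dotDl (dotC (p4 *m _)) (dotC ps); ring.
Qed.

Let U_moment x' m : U t x' m = \int[m]_y quad p2 y + quad p3 (mean m)
  + dot (2 *: (p4^T *m x' + pth)) (mean m) + (quad p1 x' + 2 * dot x' ps + pr).
Proof.
by rewrite UE /qform dotZl dotDl dot_mull trmxK (dotC pth); ring.
Qed.

Let sym2 (M : 'M[R]_n) : sym_mx M -> M + M^T = 2 *: M.
Proof. by move=> Ms; rewrite Ms scaler_nat mulr2n. Qed.

Let grad_dot (u v : 'cV[R]_n) : (u^T *m v) 0 0 = dot u v.
Proof. by []. Qed.

Lemma master_rhs_qform x mu : master_rhs lq c T U t x mu =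
  qform
    (d1 + 2 *: (p1 *m E) + Q + P *m K *m P)
    (d2 + 2 *: (p2 *m E) - 2 *: (P *m K *m Psi - Q *m Gam) - 2 *: (P *m Gh))
    (d3 + 2 *: (Gh^T *m p2) + 2 *: (p3 *m (E + Gh)) - Gam^T *m Q *m Gam
     - Psi *m K *m Psi + 2 *: (p4^T *m Gh) - 2 *: (Psi *m Gh))
    (d4 + p1 *m Gh + E^T *m p4 + p4 *m (E + Gh) - Q *m Gam + P *m K *m Psi
     + Gam^T *m Q *m Gam + Psi *m K *m Psi + Psi *m K *m P - Gam^T *m Q
     + Gh^T *m (Psi + P))
    (ds - p1 *m K *m s + E^T *m ps - p4 *m K *m s - Q *m eta + P *m K *m s
     + Gam^T *m Q *m eta + Psi *m K *m s + Gh^T *m s)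
    (dth + Gh^T *m ps + (E + Gh)^T *m pth - (p2 + p3 + p4^T) *m K *m s - Gh^T *m s)
    (dr - 2 * dot ps (K *m s) - 2 * dot pth (K *m s) + quad Q eta + quad K s
     + \tr ((p1 + p2) *m (Sig lq + S0)) + 2 * \tr (p4 *m S0)
     + \tr (p3 *m S0) + \tr (Psi *m Sig lq))
    x mu.
Proof.
pose add := fun a b : R => a + b; have Psis : sym_mx Psi by exact: trmx_mean_gain.
apply: etrans (master_identity mu d1 d2 d3 d4 p4 E Gh Gam (Sig lq) S0 ds dth ps pth
  s eta x dr p1s p2s p3s (trmx_lqK lq) (trmx_lqQ lq) Psym Psis).
rewrite /master_rhs dUE.
(* Splits the sum into one goal per term; the time derivative already agrees by [dUE]. *)
refine (congr2 add (congr2 add (congr2 add (congr2 add (congr2 add (congr2 add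
  (congr2 add (congr2 add (congr2 add (congr2 add (erefl _) _) _) _) _) _) _) _) _) _) _).
- rewrite (grad_quadratic _ (U_x mu)) (sym2 p1s) grad_dot fstarE.
  by rewrite -scalemxAl -scalerDr.
- by rewrite (hess_quadratic _ (U_x mu)).
- exact: LstarE.
- rewrite -Rintegral_dot_affine; apply: eq_Rintegral => y _.
  rewrite (grad_delta_moment _ _ (U_moment x)) (sym2 p2s) (sym2 p3s) grad_dot fstarE.
  by rewrite -!addrA -[2 *: p3 *m _]scalemxAl -scalerDr.
- apply: (congr1 (fun a => 2^-1 * a)); rewrite -[RHS](Rintegral_prob_cst mu); apply: eq_Rintegral => y _.
  by rewrite (hess_delta_moment _ _ (U_moment x)).
- rewrite -[RHS](Rintegral_prob_cst mu); apply: eq_Rintegral => y _.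
  (* The last argument is the normalising constant of [delta (U t x') mu], which varies with
     [x']. *)
  rewrite (@mixed_quadratic _ _ _ p2 (2 *: p4^T) (2 *: p3 *m mean mu + 2 *: pth)
    (fun x' => - (\int[mu]_z quad p2 z +
       dot (2 *: p3 *m mean mu + 2 *: (p4^T *m x' + pth)) (mean mu)))).
    by rewrite trmxZ trmxK.
  move=> x' y'; rewrite (delta_moment _ (U_moment x')) (sym2 p3s).
  by rewrite scalerDr -[2 *: p4^T *m _]scalemxAl [2 *: p3 *m _ + (_ + _)]addrCA.
- apply: (congr1 (fun a => 2^-1 * a)); rewrite -[RHS](Rintegral_prod_cst mu); apply: eq_Rintegral => y _.
  by rewrite (mixed_delta2_moment _ _ _ (U_moment x)).
- rewrite -Rintegral_dot_affine; apply: eq_Rintegral => y _.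
  rewrite (delta_LstarE lq Psym Lsym) -dotZl mulNmx mul1mx [- y + x]addrC.
  congr dot; rewrite -[2 *: _ *m y]scalemxAl -scalerDr; congr (_ *: _).
  rewrite !mulmxDr !mulmxDl !mulNmx !mulmxN !mulmxA -/Psi -/P -/K -/Q -/Gam -/s -/eta.
  by apply/colP => i; rewrite !mxE; ring.
- rewrite -Rintegral_dot_affine; apply: eq_Rintegral => y _.
  rewrite delta_fstarE (grad_delta_moment _ _ (UbarE c t)) grad_dot.
  rewrite (sym2 Psym) (sym2 Psis) -[2 *: Psi *m _]scalemxAl -scalerDr.
  by rewrite mulNmx mulmxBr [- _ + _]addrC.
- apply: (congr1 (fun a => 2^-1 * a)); rewrite -[RHS](Rintegral_prob_cst mu); apply: eq_Rintegral => y _.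
  by rewrite (mixed_delta2_moment _ _ _ (UbarE c t)).
Qed.

End MasterQuadratic.

(** * Time-dependent coefficients *)

Section Coefficients.
Context (R : realType) (n : nat).
Implicit Types (mu : P2 R n) (x y : 'cV[R]_n).

(* [k1], ..., [k4], [kS], [kth], [kr] are the paper's Pi_1, ..., Pi_4, S, theta, r
   with a diamond. *)
Record qcoefs := QCoefs {
  k1 : R -> 'M[R]_n ; k2 : R -> 'M[R]_n ; k3 : R -> 'M[R]_n ; k4 : R -> 'M[R]_n ;
  kS : R -> 'cV[R]_n ; kth : R -> 'cV[R]_n ; kr : R -> R }.

Definition qfun (k : qcoefs) : R -> 'cV[R]_n -> P2 R n -> R :=
  quadratic_fun (k1 k) (k2 k) (k3 k) (k4 k) (kS k) (kth k) (kr k).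

Lemma qfunE k t x mu :
  qfun k t x mu = qform (k1 k t) (k2 k t) (k3 k t) (k4 k t) (kS k t) (kth k t) (kr k t) x mu.
Proof. by []. Qed.

Definition sym_coefs (T : R) (k : qcoefs) : Prop := forall t, 0 <= t <= T ->
  [/\ sym_mx (k1 k t), sym_mx (k2 k t) & sym_mx (k3 k t)].

(** The time derivatives form a second bundle [d], so that the time derivative of [qfun k] is again
    a [qfun], namely [qfun d]. *)
Definition ode_coefs (T : R) (k d : qcoefs) : Prop :=
  [/\ [/\ ode_on T (k1 k) (k1 d), ode_on T (k2 k) (k2 d), ode_on T (k3 k) (k3 d) &
          ode_on T (k4 k) (k4 d)],
      ode_on T (kS k) (kS d), ode_on T (kth k) (kth d) & ode_on T (kr k) (kr d)].

Lemma quadratic_classP (T : R) U : quadratic_class T U <->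
  exists k d, [/\ ode_coefs T k d, sym_coefs T k &
    forall t x mu, 0 <= t <= T -> U t x mu = qfun k t x mu].
Proof.
split.
- move=> [M1 [M2 [M3 [M4 [S [th [r [[h1 h2 h3 h4] [hS hth hr] hs hU]]]]]]]].
  exists (QCoefs M1 M2 M3 M4 S th r).
  exists (QCoefs (deriv_on T M1) (deriv_on T M2) (deriv_on T M3) (deriv_on T M4)
    (deriv_on T S) (deriv_on T th) (deriv_on T r)).
  split; [|exact: hs|exact: hU].
  by split; [split; [exact: h1|exact: h2|exact: h3|exact: h4]|exact: hS|exact: hth|exact: hr].
- move=> [k [d [[[h1 h2 h3 h4] hS hth hr] hs hU]]].
  exists (k1 k), (k2 k), (k3 k), (k4 k), (kS k), (kth k), (kr k); split.
  + split=> t tT; [exact: (cvgP _ (h1 t tT))|exact: (cvgP _ (h2 t tT))|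
      exact: (cvgP _ (h3 t tT))|exact: (cvgP _ (h4 t tT))].
  + split=> t tT; [exact: (cvgP _ (hS t tT))|exact: (cvgP _ (hth t tT))|
      exact: (cvgP _ (hr t tT))].
  + exact: hs.
  + exact: hU.
Qed.

(** At fixed [x] and [mu] the value of [qfun] is linear in the coefficients. *)
Lemma quot_on_qfun (T : R) k d t x mu : ode_coefs T k d -> 0 <= t <= T ->
  quot_on T (fun s => qfun k s x mu) t --> qfun d t x mu.
Proof.
move=> [[h1 h2 h3 h4] hS hth hr] tT; rewrite qfunE /qform.
apply: quot_onD (hr t tT).
apply: quot_onD; last first.
  apply: (quot_on_linear (L := fun u => 2 * dot (mean mu) u)) (hth t tT).
  by move=> a u v; rewrite dotDr dotZr /GRing.scale/=; ring.
apply: quot_onD; last first.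
  apply: (quot_on_linear (L := fun u => 2 * dot x u)) (hS t tT).
  by move=> a u v; rewrite dotDr dotZr /GRing.scale/=; ring.
apply: quot_onD; last first.
  apply: (quot_on_linear (L := fun M => 2 * dot x (M *m mean mu))) (h4 t tT).
  by move=> a u v; rewrite mulmxDl mulmxZl dotDr dotZr /GRing.scale/=; ring.
apply: quot_onD; last first.
  apply: (quot_on_linear (L := fun M => quad M (mean mu))) (h3 t tT).
  by move=> a u v; rewrite quadDl quadZl.
apply: quot_onD.
  apply: (quot_on_linear (L := fun M => quad M x)) (h1 t tT).
  by move=> a u v; rewrite quadDl quadZl.
apply: (quot_on_linear (L := fun M => \int[mu]_y quad M y)) (h2 t tT).
by move=> a u v; rewrite Rintegral_quadD Rintegral_quadZ.
Qed.

(** A symmetric path and its transpose have the same difference quotients on [[0, T]], and limits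
    are unique. [sym_lyapunov] relies on this to recover a derivative from its symmetric part. *)
Lemma ode_on_sym (T : R) (M D : R -> 'M[R]_n) : 0 < T -> ode_on T M D ->
  (forall t, 0 <= t <= T -> sym_mx (M t)) -> forall t, 0 <= t <= T -> sym_mx (D t).
Proof.
move=> T0 MD Ms t tT.
have Mt : quot_on T M t --> (D t)^T.
  apply: (@quot_on_eq _ _ _ (fun s => (M s)^T) _ _ _ tT) => [s sT|]; first exact: Ms.
  apply: quot_on_mx => i j; rewrite mxE.
  under [X in quot_on _ X _]eq_fun do rewrite mxE.
  exact: quot_on_coord (MD t tT).
by rewrite /sym_mx -(deriv_onE T0 tT Mt) (deriv_onE T0 tT (MD t tT)).
Qed.

(** Converse of [qform_eq0]: skew quadratic coefficients already give the zero form. *)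
Lemma qfun_skew_eq0 k t x mu :
  [/\ k1 k t + (k1 k t)^T = 0, k2 k t + (k2 k t)^T = 0 & k3 k t + (k3 k t)^T = 0] ->
  [/\ k4 k t = 0, kS k t = 0, kth k t = 0 & kr k t = 0] -> qfun k t x mu = 0.
Proof.
have skew (M : 'M[R]_n) y : M + M^T = 0 -> quad M y = 0.
  move=> M0; suff : quad (M + M^T) y = 0 by rewrite quadDl quad_tr; lra.
  by rewrite M0 quad0l.
move=> [h1 h2 h3] [h4 hS hth hr]; rewrite qfunE /qform h4 hS hth hr mul0mx !dot0r.
have -> : \int[mu]_y quad (k2 k t) y = 0.
  by rewrite -[RHS](Rintegral_prob_cst mu); apply: eq_Rintegral => y _; exact: skew.
by rewrite (skew _ _ h1) (skew _ _ h3); ring.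
Qed.

End Coefficients.

Section MasterCoefs.
Context (R : realType) (n n1 n2 n3 : nat) (lq : lq_data R n n1 n2 n3).
Context (c : riccati_fun R n).
Let K := lqK lq.
Let Q := lqQ lq.
Let Gam := lqGam lq.
Let eta := lqeta lq.
Let Gh := Ghat lq c.
Let Psi := mean_gain c.
Let E := closed_loop lq c.
Let P := rP c.
Let s t := rS c t + rth c t.

Definition master_coefs (k d : qcoefs R n) : qcoefs R n := QCoefs
  (fun t => k1 d t + 2 *: (k1 k t *m E t) + Q + P t *m K *m P t)
  (fun t => k2 d t + 2 *: (k2 k t *m E t) - 2 *: (P t *m K *m Psi t - Q *m Gam)
     - 2 *: (P t *m Gh t))
  (fun t => k3 d t + 2 *: ((Gh t)^T *m k2 k t) + 2 *: (k3 k t *m (E t + Gh t))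
     - Gam^T *m Q *m Gam - Psi t *m K *m Psi t + 2 *: ((k4 k t)^T *m Gh t)
     - 2 *: (Psi t *m Gh t))
  (fun t => k4 d t + k1 k t *m Gh t + (E t)^T *m k4 k t + k4 k t *m (E t + Gh t)
     - Q *m Gam + P t *m K *m Psi t
     + Gam^T *m Q *m Gam + Psi t *m K *m Psi t + Psi t *m K *m P t - Gam^T *m Q
     + (Gh t)^T *m (Psi t + P t))
  (fun t => kS d t - k1 k t *m K *m s t + (E t)^T *m kS k t - k4 k t *m K *m s t
     - Q *m eta + P t *m K *m s t
     + Gam^T *m Q *m eta + Psi t *m K *m s t + (Gh t)^T *m s t)
  (fun t => kth d t + (Gh t)^T *m kS k t + (E t + Gh t)^T *m kth k t
     - (k2 k t + k3 k t + (k4 k t)^T) *m K *m s t - (Gh t)^T *m s t)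
  (fun t => kr d t - 2 * dot (kS k t) (K *m s t) - 2 * dot (kth k t) (K *m s t)
     + quad Q eta + quad K (s t)
     + \tr ((k1 k t + k2 k t) *m (Sig lq + Sig0 lq)) + 2 * \tr (k4 k t *m Sig0 lq)
     + \tr (k3 k t *m Sig0 lq) + \tr (Psi t *m Sig lq)).

Lemma master_rhs_coefs (T t : R) U k d x mu : 0 < T -> 0 <= t <= T ->
  sym_mx (rP c t) -> sym_mx (rLam c t) -> ode_coefs T k d -> sym_coefs T k ->
  (forall t x mu, 0 <= t <= T -> U t x mu = qfun k t x mu) ->
  master_rhs lq c T U t x mu = qfun (master_coefs k d) t x mu.
Proof.
move=> T0 tT Psym Lsym kd ks Uk; have [s1 s2 s3] := ks t tT.
apply: (@master_rhs_qform _ _ _ _ _ lq c t T Psym Lsym U (k1 k t) (k2 k t) (k3 k t) (k4 k t)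
  (k1 d t) (k2 d t) (k3 d t) (k4 d t) (kS k t) (kth k t) (kS d t) (kth d t) (kr k t) (kr d t)
  s1 s2 s3) => y m; first by rewrite Uk.
rewrite -qfunE; apply: (deriv_onE T0 tT).
apply: (@quot_on_eq _ _ _ (fun s => qfun k s y m) _ _ _ tT) => [s' sT|]; first by rewrite Uk.
exact: quot_on_qfun.
Qed.

End MasterCoefs.

(** * Entrywise matrix computations *)

Section MatrixIdentities.
Context (R : realType).

Lemma mx_entryD m k (M N : 'M[R]_(m, k)) i j : (M + N) i j = M i j + N i j.
Proof. by rewrite mxE. Qed.

Lemma mx_entryN m k (M : 'M[R]_(m, k)) i j : (- M) i j = - M i j.
Proof. by rewrite mxE. Qed.

Lemma mx_entryZ m k a (M : 'M[R]_(m, k)) i j : (a *: M) i j = a * M i j.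
Proof. by rewrite mxE. Qed.

Lemma mx_entry0 m k i j : (0 : 'M[R]_(m, k)) i j = 0.
Proof. by rewrite mxE. Qed.

Definition mx_entryE := (mx_entryD, mx_entryN, mx_entryZ, mx_entry0).

End MatrixIdentities.

(** Matrix products do not commute, so [ring] is applied to entries: [mx_distr] expands into
    left-associated monomials, and [mx_ring] treats the entries of each monomial as atoms. *)
Ltac mx_distr := rewrite ?(trmxD, trmxN, trmxZ, trmx_mul, trmxK);
  rewrite ?(mulmxDl, mulNmx, mulmxZl); rewrite ?(mulmxDr, mulmxN, mulmxZr);
  rewrite ?mulmxA.

Ltac mx_ring := apply/matrixP => ? ?; rewrite !mx_entryE; ring.

(** * Existence *)

Section ExistenceIdentities.
Context (R : realType) (n : nat).
Variables (A G K Q Gam P Lam H o1 o2 : 'M[R]_n) (S th eta tho : 'cV[R]_n).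
Hypotheses (Ks : K^T = K) (Qs : Q^T = Q) (Ps : P^T = P) (Ls : Lam^T = Lam).
Let Psi := Lam + H + H^T.
Let E := A - K *m P.
Let Gh := G - K *m Psi.
Let F := A + G - K *m (P + Lam + H + H^T).
Let F' := A + Gh - K *m P.
Let s := S + th.
Let dP := - (A^T *m P) - P *m A + P *m K *m P - Q.
Let dLam := - ((Lam + H) *m K *m (Lam + H^T)) - Lam *m F - F^T *m Lam
  + H^T *m K *m H - H^T *m G - G^T *m H - Gam^T *m Q *m Gam.
Let dH := - (A^T *m H) + P *m K *m H - H *m F - P *m G + Q *m Gam.
Let dS := - (A^T *m S) + P *m K *m S + H *m K *m (S + th) + Q *m eta.
Let dth := H^T *m K *m S + Lam *m K *m (S + th) - F^T *m th
  - (Lam + H) *m K *m th - G^T *m S - Gam^T *m Q *m eta.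
Let do1 := - (o1 *m E) - E^T *m o1 - (H *m Gh + Gh^T *m H^T).
Let do2 := - (o2 *m F') - F'^T *m o2 - o1 *m Gh - Gh^T *m o1 + H *m Gh + Gh^T *m H^T.
Let dtho := - (F'^T *m tho) + (o1 + o2) *m K *m s.

(** By the Riccati equation [X] reduces to [P *m A - A^T *m P], which is skew but in general not
    zero. *)
Lemma master_coef1 (X := dP + 2 *: (P *m E) + Q + P *m K *m P) : X + X^T = 0.
Proof.
rewrite /X /dP /E; mx_distr; rewrite ?(Ks, Qs, Ps, Ls); mx_ring.
Qed.

Hypothesis o1s : o1^T = o1.

Lemma master_coef2 (X := (do1 - dH - dH^T) + 2 *: ((o1 - H - H^T) *m E)
   - 2 *: (P *m K *m Psi - Q *m Gam) - 2 *: (P *m Gh)) : X + X^T = 0.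
Proof.
rewrite /X /do1 /dH /Gh /E /F /Psi; mx_distr; rewrite ?(Ks, Qs, Ps, Ls, o1s); mx_ring.
Qed.

Hypothesis o2s : o2^T = o2.

Lemma master_coef3 (X := (do2 - dLam) + 2 *: (Gh^T *m (o1 - H - H^T))
   + 2 *: ((o2 - Lam) *m (E + Gh)) - Gam^T *m Q *m Gam - Psi *m K *m Psi
   + 2 *: (Psi^T *m Gh) - 2 *: (Psi *m Gh)) : X + X^T = 0.
Proof.
rewrite /X /do2 /dLam /Gh /E /F /F' /Gh /Psi; mx_distr.
rewrite ?(Ks, Qs, Ps, Ls, o1s, o2s); mx_ring.
Qed.

(** This coefficient pairs the independent vectors [x] and [mean mu], so it has to vanish itself and
    not merely up to a skew part. The leading bracket is the derivative of [Psi]. *)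
Lemma master_coef4 :
  (dLam + dH + dH^T) + P *m Gh + E^T *m Psi + Psi *m (E + Gh)
   - Q *m Gam + P *m K *m Psi + Gam^T *m Q *m Gam + Psi *m K *m Psi
   + Psi *m K *m P - Gam^T *m Q + Gh^T *m (Psi + P) = 0.
Proof.
rewrite /dH /dLam /Gh /E /F /Psi; mx_distr; rewrite ?(Ks, Qs, Ps, Ls); mx_ring.
Qed.

Lemma master_coefS :
  (dS + dth) - P *m K *m s + E^T *m s - Psi *m K *m s - Q *m eta
   + P *m K *m s + Gam^T *m Q *m eta + Psi *m K *m s + Gh^T *m s = 0.
Proof.
rewrite /dS /dth /Gh /E /F /Psi /s; mx_distr; rewrite ?(Ks, Qs, Ps, Ls); mx_ring.
Qed.

Lemma master_coefth :
  dtho + Gh^T *m s + (E + Gh)^T *m tho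
   - ((o1 - H - H^T) + (o2 - Lam) + Psi^T) *m K *m s - Gh^T *m s = 0.
Proof.
rewrite /dtho /F' /Gh /E /Psi /s; mx_distr; rewrite ?(Ks, Qs, Ps, Ls); mx_ring.
Qed.

Variables (n2 n3 : nat) (D : 'M[R]_(n, n2)) (D0 : 'M[R]_(n, n3)).

Lemma master_coefr :
  (quad K S + dot th (K *m (2 *: S + th))
    - \tr ((P + Lam + H + H^T) *m D0 *m D0^T) - \tr (P *m D *m D^T) - quad Q eta
   + (2 * dot tho (K *m s)
      - \tr ((o1 + Lam) *m D *m D^T + (o1 + o2) *m D0 *m D0^T)))
  - 2 * dot s (K *m s) - 2 * dot tho (K *m s) + quad Q eta + quad K s
  + \tr ((P + (o1 - H - H^T)) *m (D *m D^T + D0 *m D0^T)) + 2 * \tr (Psi *m (D0 *m D0^T))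
  + \tr ((o2 - Lam) *m (D0 *m D0^T)) + \tr (Psi *m (D *m D^T)) = 0.
Proof.
rewrite /Psi /s -!mulmxA; move: (D *m D^T) (D0 *m D0^T) => Sg Sg0.
rewrite !(mulmxDl, mulNmx, mulmxDr, mxtraceD, raddfN) /= /quad !(mulmxDr, mulmxZr).
rewrite !(dotDl, dotDr, dotZr) (dot_flip th S) Ks.
by ring.
Qed.

End ExistenceIdentities.

(** * The terminal condition *)

Section Terminal.
Context (R : realType) (n n1 n2 n3 : nat) (lq : lq_data R n n1 n2 n3).

Lemma terminal_identity (mu : P2 R n) (Q Gam : 'M[R]_n) (x eta : 'cV[R]_n) :
  Q^T = Q ->
  let m := mean mu in
  let a := 2 *: (Gam^T *m Q *m Gam *m m + Gam^T *m Q *m eta) in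
  quad Q (x - Gam *m m - eta)
  + (\int[mu]_y quad ((- (2 *: (Gam^T *m Q)))^T *m - 1%:M) y
     + dot ((- (2 *: (Gam^T *m Q)))^T *m x + (- 1%:M)^T *m a) m + dot a x)
  = qform Q (Q *m Gam + Gam^T *m Q) (- (Gam^T *m Q *m Gam))
      (Gam^T *m Q *m Gam - Q *m Gam - Gam^T *m Q) (Gam^T *m Q *m eta - Q *m eta) 0
      (quad Q eta) x mu.
Proof.
move=> Qs m a; rewrite {}/a {}/m /qform.
have -> : (- (2 *: (Gam^T *m Q)))^T *m - 1%:M = 2 *: (Q *m Gam).
  by rewrite mulmxN mulmx1 trmxN opprK trmxZ trmx_mul trmxK Qs.
(* The computation yields [2 *: (Q *m Gam)]; its symmetric part is stated instead, to agree with the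
   terminal value of [- H - H^T]. *)
have -> : \int[mu]_y quad (Q *m Gam + Gam^T *m Q) y = \int[mu]_y quad (2 *: (Q *m Gam)) y.
  apply: eq_Rintegral => y _; rewrite quadDl quadZl -[quad (Gam^T *m Q) y]quad_tr.
  by rewrite trmx_mul trmxK Qs; ring.
move: (\int[mu]_y _) (mean mu) => i m.
rewrite !trmxN trmx1 dot0r !mulNmx mul1mx /quad !(mx_expand, dot_expand) ?Qs.
rewrite !(dot_flip m x, dot_flip eta x, dot_flip eta m) !(mx_expand, Qs).
by ring.
Qed.

Let Q := lqQf lq.
Let Gam := lqGamf lq.
Let eta := lqetaf lq.

Lemma term_costE_moment (y : 'cV[R]_n) (mu : P2 R n) : term_cost lq y mu =
  \int[mu]_z quad (0 : 'M[R]_n) z + quad (Gam^T *m Q *m Gam) (mean mu)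
  + dot (- (2 *: (Gam^T *m Q *m (y - eta)))) (mean mu) + quad Q (y - eta).
Proof.
have [Qs _] := lqQf_psd lq.
have := feedback_cost_expand Gam y eta 0 (mean mu) Qs (@trmx0 _ n n) (@trmx0 _ n n) (@trmx0 _ n n).
rewrite !(mul0mx, mulmx0) !quad0l !addr0 sub0r => E.
by rewrite /term_cost E Rintegral_quad0 add0r scalerN.
Qed.

Lemma terminal_qform (x : 'cV[R]_n) (mu : P2 R n) :
  term_cost lq x mu + \int[mu]_y (delta (term_cost lq y) mu x - delta (term_cost lq y) mu y) =
  qform Q (Q *m Gam + Gam^T *m Q) (- (Gam^T *m Q *m Gam))
    (Gam^T *m Q *m Gam - Q *m Gam - Gam^T *m Q) (Gam^T *m Q *m eta - Q *m eta) 0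
    (quad Q eta) x mu.
Proof.
have [Qs _] := lqQf_psd lq.
rewrite -(terminal_identity mu Gam x eta Qs); congr (_ + _).
rewrite -Rintegral_dot_affine; apply: eq_Rintegral => y _.
rewrite !(delta_moment _ (term_costE_moment y)) !quad0l (trmx_congr _ Qs).
set w := (_ + _) *m _ + _; have -> : w = - (2 *: (Gam^T *m Q)) *m y
    + 2 *: (Gam^T *m Q *m Gam *m mean mu + Gam^T *m Q *m eta).
  rewrite /w mulmxDl mulmxDr mulmxN mulNmx mulmxZl.
  by apply/colP => i; rewrite !mx_entryE; ring.
by rewrite !mulNmx mul1mx !(dotDr, dotNr); ring.
Qed.

End Terminal.
(** * Uniqueness *)

Section Uniqueness.
Context (R : realType) (n : nat).

(** Adding the transpose doubles [D] and replaces [2 Z E] by [2 (Z E + E^T Z)], which is a Lyapunov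
    equation in the form that [linear_ode_eq0] takes. *)
Lemma sym_lyapunov (D Z E : 'M[R]_n) : sym_mx D -> sym_mx Z ->
  (D + 2 *: (Z *m E)) + (D + 2 *: (Z *m E))^T = 0 -> D = - E^T *m Z + Z *m - E.
Proof.
move=> Ds Zs; mx_distr; rewrite Ds Zs => /matrixP h; apply/matrixP => i j.
by have := h i j; rewrite !mx_entryE; lra.
Qed.

Lemma sylvester (m k : nat) (D Z : 'M[R]_(m, k)) E F :
  D + E^T *m Z + Z *m F = 0 -> D = - E^T *m Z + Z *m - F.
Proof.
rewrite mulNmx mulmxN => /matrixP h; apply/matrixP => i j.
by have := h i j; rewrite !mx_entryE; lra.
Qed.

Context (n1 n2 n3 : nat) (lq : lq_data R n n1 n2 n3) (c : riccati_fun R n) (T : R).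
Hypothesis T0 : 0 < T.
Variables k d k' d' : qcoefs R n.
Hypotheses (kd : ode_coefs T k d) (kd' : ode_coefs T k' d').
Hypotheses (ks : sym_coefs T k) (ks' : sym_coefs T k').
Hypothesis master0 : forall t x mu, 0 <= t <= T -> qfun (master_coefs lq c k d) t x mu = 0.
Hypothesis master0' : forall t x mu, 0 <= t <= T -> qfun (master_coefs lq c k' d') t x mu = 0.
Hypothesis terminal : forall x mu, qfun k T x mu = qfun k' T x mu.
Hypotheses (Ebnd : mx_bounded T (closed_loop lq c)) (Gbnd : mx_bounded T (Ghat lq c)).

Let E := closed_loop lq c.
Let Gh := Ghat lq c.

Lemma master_diff t : 0 <= t <= T ->
  let a := master_coefs lq c k d in let b := master_coefs lq c k' d' in
  [/\ [/\ (k1 a t - k1 b t) + (k1 a t - k1 b t)^T = 0,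
          (k2 a t - k2 b t) + (k2 a t - k2 b t)^T = 0 &
          (k3 a t - k3 b t) + (k3 a t - k3 b t)^T = 0],
      k4 a t - k4 b t = 0, kS a t - kS b t = 0, kth a t - kth b t = 0 &
      kr a t - kr b t = 0].
Proof.
move=> tT a b; apply: qform_eq0 => x mu.
by rewrite qformD qformN -!qfunE master0// master0'// subrr.
Qed.

Lemma ode_onB (W : normedModType R) (f g v w : R -> W) : ode_on T f v -> ode_on T g w ->
  ode_on T (fun t => f t - g t) (fun t => v t - w t).
Proof. by move=> fv gw t tT; apply: quot_onD; [exact: fv|apply: quot_onN; exact: gw]. Qed.

Lemma ode_on_eq (W : normedModType R) (f v w : R -> W) : ode_on T f v ->
  (forall t, 0 <= t <= T -> v t = w t) -> ode_on T f w.
Proof. by move=> fv vw t tT; rewrite -vw//; exact: fv. Qed.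

Lemma sym_mxB (M N : 'M[R]_n) : sym_mx M -> sym_mx N -> sym_mx (M - N).
Proof. by move=> Ms Ns; rewrite /sym_mx trmxD trmxN Ms Ns. Qed.

(** Serves both to compare two solutions of the coefficient system and to compare a path with its
    transpose. *)
Lemma linear_ode_eq m l (p p' v v' : R -> 'M[R]_(m, l)) (F : R -> 'M[R]_m) (G : R -> 'M[R]_l) :
  mx_bounded T F -> mx_bounded T G -> ode_on T p v -> ode_on T p' v' ->
  (forall t, 0 <= t <= T -> v t - v' t = - F t *m (p t - p' t) + (p t - p' t) *m - G t) ->
  p T = p' T -> forall t, 0 <= t <= T -> p t = p' t.
Proof.
move=> Fb Gb pv pv' vE pT t tT; apply: subr0_eq.
apply: (@linear_ode_eq0 _ T _ _ (fun t => p t - p' t) (fun t => - F t) (fun t => - G t)) => //.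
- exact: mx_boundedN.
- exact: mx_boundedN.
- exact: (ode_on_eq (ode_onB pv pv') vE).
- by rewrite pT subrr.
Qed.

Lemma master_coefs_unique t : 0 <= t <= T ->
  [/\ [/\ k1 k t = k1 k' t, k2 k t = k2 k' t & k3 k t = k3 k' t],
      k4 k t = k4 k' t, kS k t = kS k' t, kth k t = kth k' t & kr k t = kr k' t].
Proof.
have TT : 0 <= T <= T by rewrite lexx ltW.
have [[d1s d2s d3s d4s] dSs dths drs] := kd.
have [[d1s' d2s' d3s' d4s'] dSs' dths' drs'] := kd'.
have s1 u (uT : 0 <= u <= T) : sym_mx (k1 k u) by case: (ks uT).
have s2 u (uT : 0 <= u <= T) : sym_mx (k2 k u) by case: (ks uT).
have s3 u (uT : 0 <= u <= T) : sym_mx (k3 k u) by case: (ks uT).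
have s1' u (uT : 0 <= u <= T) : sym_mx (k1 k' u) by case: (ks' uT).
have s2' u (uT : 0 <= u <= T) : sym_mx (k2 k' u) by case: (ks' uT).
have s3' u (uT : 0 <= u <= T) : sym_mx (k3 k' u) by case: (ks' uT).
have [[T1 T2 T3] T4 TS Tth Tr] :=
  qform_inj (s1 T TT) (s2 T TT) (s3 T TT) (s1' T TT) (s2' T TT) (s3' T TT) terminal.
have Etb := mx_bounded_tr Ebnd.
have EGb := mx_boundedD Ebnd Gbnd.
have EGtb := mx_bounded_tr EGb.
(* For the column vectors [kS] and [kth] the right factor is a 1 by 1 matrix, taken to be zero. *)
have zb : mx_bounded T (fun=> 0 : 'M[R]_1) by exact: mx_bounded_cst.
have e1 : forall u, 0 <= u <= T -> k1 k u = k1 k' u.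
  apply: (linear_ode_eq Etb Ebnd d1s d1s' _ T1) => u uT.
  have [[h _ _] _ _ _ _] := master_diff uT; apply: sym_lyapunov.
  - exact: sym_mxB (ode_on_sym T0 d1s s1 uT) (ode_on_sym T0 d1s' s1' uT).
  - exact: sym_mxB (s1 u uT) (s1' u uT).
  (* The source terms are common to both solutions and cancel in the difference. *)
  set X := (X in X + X^T); rewrite (_ : X = k1 (master_coefs lq c k d) u - k1 (master_coefs lq c k' d') u)//.
  rewrite /X /= [(k1 k u - _) *m _]mulmxBl; apply/matrixP => i j.
  by rewrite !mx_entryE; ring.
have e2 : forall u, 0 <= u <= T -> k2 k u = k2 k' u.
  apply: (linear_ode_eq Etb Ebnd d2s d2s' _ T2) => u uT.
  have [[_ h _] _ _ _ _] := master_diff uT; apply: sym_lyapunov.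
  - exact: sym_mxB (ode_on_sym T0 d2s s2 uT) (ode_on_sym T0 d2s' s2' uT).
  - exact: sym_mxB (s2 u uT) (s2' u uT).
  set X := (X in X + X^T); rewrite (_ : X = k2 (master_coefs lq c k d) u - k2 (master_coefs lq c k' d') u)//.
  rewrite /X /= [(k2 k u - _) *m _]mulmxBl; apply/matrixP => i j.
  by rewrite !mx_entryE; ring.
have e4 : forall u, 0 <= u <= T -> k4 k u = k4 k' u.
  apply: (linear_ode_eq Etb EGb d4s d4s' _ T4) => u uT.
  have [_ h _ _ _] := master_diff uT; apply: sylvester; rewrite -h /= e1//.
  rewrite [_ *m (k4 k u - _)]mulmxBr [(k4 k u - _) *m _]mulmxBl.
  by apply/matrixP => i j; rewrite !mx_entryE; ring.
have e3 : forall u, 0 <= u <= T -> k3 k u = k3 k' u.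
  apply: (linear_ode_eq EGtb EGb d3s d3s' _ T3) => u uT.
  have [[_ _ h] _ _ _ _] := master_diff uT; apply: sym_lyapunov.
  - exact: sym_mxB (ode_on_sym T0 d3s s3 uT) (ode_on_sym T0 d3s' s3' uT).
  - exact: sym_mxB (s3 u uT) (s3' u uT).
  set X := (X in X + X^T); rewrite (_ : X = k3 (master_coefs lq c k d) u - k3 (master_coefs lq c k' d') u)//.
  rewrite /X /= e2// e4// [(k3 k u - _) *m _]mulmxBl; apply/matrixP => i j.
  by rewrite !mx_entryE; ring.
have eS : forall u, 0 <= u <= T -> kS k u = kS k' u.
  apply: (linear_ode_eq Etb zb dSs dSs' _ TS) => u uT.
  have [_ _ h _ _] := master_diff uT; apply: sylvester; rewrite -h /= e1// e4//.
  rewrite [_ *m (kS k u - _)]mulmxBr mulmx0 addr0.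
  by apply/matrixP => i j; rewrite !mx_entryE; ring.
have eth : forall u, 0 <= u <= T -> kth k u = kth k' u.
  apply: (linear_ode_eq EGtb zb dths dths' _ Tth) => u uT.
  have [_ _ _ h _] := master_diff uT; apply: sylvester; rewrite -h /= e2// e3// e4// eS//.
  rewrite [_ *m (kth k u - _)]mulmxBr mulmx0 addr0.
  by apply/matrixP => i j; rewrite !mx_entryE; ring.
have er : forall u, 0 <= u <= T -> kr d u = kr d' u.
  move=> u uT; have [_ _ _ _ h] := master_diff uT; apply: subr0_eq.
  by rewrite -h /= e1// e2// e3// e4// eS// eth//; ring.
move=> tT; split; [by split; [exact: e1|exact: e2|exact: e3]|exact: e4|exact: eS|exact: eth|].
(* Equal derivatives and equal terminal values: Gronwall with [C = 0], applied to both
   differences. *)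
apply/eqP; rewrite eq_le; apply/andP; split; rewrite -subr_le0.
- apply: (gronwall_le0 (C := 0) T0 (ode_onB drs drs')) => // [u uT|].
    by rewrite mul0r oppr0 er// subrr.
  by rewrite Tr subrr.
- apply: (gronwall_le0 (C := 0) T0 (ode_onB drs' drs)) => // [u uT|].
    by rewrite mul0r oppr0 er// subrr.
  by rewrite Tr subrr.
Qed.

End Uniqueness.

(** * The stated coefficients solve the system *)

Section Existence.
Context (R : realType) (n n1 n2 n3 : nat) (lq : lq_data R n n1 n2 n3) (T : R).
Hypothesis T0 : 0 < T.
Variables (c : riccati_fun R n) (o : linear_fun R n).
Hypotheses (hc : is_riccati_solution lq T c) (ho : is_linear_solution lq c T o).

Let A := lqA lq.
Let G := lqG lq.
Let K := lqK lq.
Let Q := lqQ lq.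
Let Gam := lqGam lq.
Let eta := lqeta lq.
Let P := rP c.
Let Lam := rLam c.
Let H := rH c.
Let S := rS c.
Let th := rth c.
Let o1 := oPi1 o.
Let o2 := oPi2 o.
Let tho := oth o.
Let E := closed_loop lq c.
Let Gh := Ghat lq c.
Let F t := A + G - K *m (P t + Lam t + H t + (H t)^T).
Let F' t := A + Gh t - K *m P t.
Let s t := S t + th t.
Let dP t := - (A^T *m P t) - P t *m A + P t *m K *m P t - Q.
Let dLam t := - ((Lam t + H t) *m K *m (Lam t + (H t)^T)) - Lam t *m F t
  - (F t)^T *m Lam t + (H t)^T *m K *m H t - (H t)^T *m G - G^T *m H t
  - Gam^T *m Q *m Gam.
Let dH t := - (A^T *m H t) + P t *m K *m H t - H t *m F t - P t *m G + Q *m Gam.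
Let dS t := - (A^T *m S t) + P t *m K *m S t + H t *m K *m (S t + th t) + Q *m eta.
Let dth t := (H t)^T *m K *m S t + Lam t *m K *m (S t + th t) - (F t)^T *m th t
  - (Lam t + H t) *m K *m th t - G^T *m S t - Gam^T *m Q *m eta.
Let dr t := quad K (S t) + dot (th t) (K *m (2 *: S t + th t))
  - \tr ((P t + Lam t + H t + (H t)^T) *m lqD0 lq *m (lqD0 lq)^T)
  - \tr (P t *m lqD lq *m (lqD lq)^T) - quad Q eta.
Let do1 t := - (o1 t *m E t) - (E t)^T *m o1 t - (H t *m Gh t + (Gh t)^T *m (H t)^T).
Let do2 t := - (o2 t *m F' t) - (F' t)^T *m o2 t - o1 t *m Gh t - (Gh t)^T *m o1 t
  + H t *m Gh t + (Gh t)^T *m (H t)^T.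
Let dtho t := - ((F' t)^T *m tho t) + (o1 t + o2 t) *m K *m s t.
Let dro t := 2 * dot (tho t) (K *m s t)
  - \tr ((o1 t + Lam t) *m lqD lq *m (lqD lq)^T + (o1 t + o2 t) *m lqD0 lq *m (lqD0 lq)^T).

Definition star_coefs : qcoefs R n := QCoefs P (fun t => o1 t - H t - (H t)^T)
  (fun t => o2 t - Lam t) (fun t => Lam t + H t + (H t)^T) (fun t => S t + th t) tho
  (fun t => rr c t + oor o t).

Definition star_derivs : qcoefs R n := QCoefs dP (fun t => do1 t - dH t - (dH t)^T)
  (fun t => do2 t - dLam t) (fun t => dLam t + dH t + (dH t)^T) (fun t => dS t + dth t) dtho
  (fun t => dr t + dro t).

Lemma ode_on_tr m k (f v : R -> 'M[R]_(m, k)) : ode_on T f v ->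
  ode_on T (fun t => (f t)^T) (fun t => (v t)^T).
Proof.
move=> fv t tT; apply: quot_on_mx => i j; rewrite mxE.
under [X in quot_on _ X _]eq_fun do rewrite mxE.
exact: quot_on_coord (fv t tT).
Qed.

Lemma ode_onD (W : normedModType R) (f g v w : R -> W) : ode_on T f v -> ode_on T g w ->
  ode_on T (fun t => f t + g t) (fun t => v t + w t).
Proof. by move=> fv gw t tT; apply: quot_onD; [exact: fv|exact: gw]. Qed.

Lemma ode_star : ode_coefs T star_coefs star_derivs.
Proof.
have [[hP hL hH] [hS hth hr] _ _ _] := hc; have [h1 h2 htho hro _] := ho.
split; [split|..].
- exact: hP.
- exact: ode_onB (ode_onB h1 hH) (ode_on_tr hH).
- exact: ode_onB h2 hL.
- exact: ode_onD (ode_onD hL hH) (ode_on_tr hH).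
- exact: ode_onD hS hth.
- exact: htho.
- exact: ode_onD hr hro.
Qed.

Lemma closed_loop_bounded : mx_bounded T E.
Proof.
have [[hP _ _] _ _ _ _] := hc.
apply: mx_boundedD; first exact: mx_bounded_cst.
apply/mx_boundedN/mx_boundedM; first exact: mx_bounded_cst.
exact: ode_on_mx_bounded T0 hP.
Qed.

Lemma Ghat_bounded : mx_bounded T Gh.
Proof.
have [[_ hL hH] _ _ _ _] := hc.
apply: mx_boundedD; first exact: mx_bounded_cst.
apply/mx_boundedN/mx_boundedM; first exact: mx_bounded_cst.
have Hb := ode_on_mx_bounded T0 hH.
apply: mx_boundedD; last exact: mx_bounded_tr.
by apply: mx_boundedD => //; exact: ode_on_mx_bounded T0 hL.
Qed.

(** The source term is symmetric, so the transpose solves the same linear equation with the same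
    terminal value. *)
Lemma sym_o1 t : 0 <= t <= T -> sym_mx (o1 t).
Proof.
have [h1 _ _ _ [h1T _ _ _]] := ho.
apply: (linear_ode_eq T0 (mx_bounded_tr closed_loop_bounded) closed_loop_bounded
  (ode_on_tr h1) h1); last by rewrite h1T trmx0.
move=> u _; rewrite -/o1 -/(Gh u) -/(H u) /E /closed_loop.
move: (o1 u) (lqA lq - lqK lq *m rP c u) (Gh u) (H u) => M E' G' H'.
by mx_distr; mx_ring.
Qed.

(** As for [o1], whose symmetry is what makes the source [- o1 Gh - Gh^T o1] symmetric. *)
Lemma sym_o2 t : 0 <= t <= T -> sym_mx (o2 t).
Proof.
have [_ h2 _ _ [_ h2T _ _]] := ho.
have EGb := mx_boundedD closed_loop_bounded Ghat_bounded.
apply: (linear_ode_eq T0 (mx_bounded_tr EGb) EGb (ode_on_tr h2) h2);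
  last by rewrite h2T trmx0.
move=> u uT; have := sym_o1 uT.
rewrite /sym_mx -/o1 -/o2 -/(Gh u) -/(H u) /E /closed_loop.
move: (o1 u) (o2 u) (lqA lq) (Gh u) (H u) (lqK lq *m rP c u) => M N A' G' H' B' Ms.
by mx_distr; rewrite ?Ms; mx_ring.
Qed.

Lemma sym_star : sym_coefs T star_coefs.
Proof.
move=> t tT; have [_ _ _ _ PL] := hc; have [Ps Ls] := PL t tT.
split; first exact: Ps; rewrite /sym_mx /= !(trmxD, trmxN).
  by rewrite (sym_o1 tT) trmxK addrAC.
by rewrite (sym_o2 tT) Ls.
Qed.

Lemma master_star_eq0 t x mu : 0 <= t <= T ->
  qfun (master_coefs lq c star_coefs star_derivs) t x mu = 0.
Proof.
move=> tT; have [_ _ _ _ PL] := hc; have [Ps Ls] := PL t tT.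
have Ks := trmx_lqK lq; have Qs := trmx_lqQ lq.
have o1s := sym_o1 tT; have o2s := sym_o2 tT.
apply: qfun_skew_eq0; split.
- exact: (master_coef1 (lqA lq) Ks Qs Ps).
- exact: (master_coef2 (lqA lq) (lqG lq) (lqGam lq) (H t) Ks Qs Ps Ls o1s).
- exact: (master_coef3 (lqA lq) (lqG lq) (lqGam lq) (H t) Ks Qs Ps Ls o1s o2s).
- exact: (master_coef4 (lqA lq) (lqG lq) (lqGam lq) (H t) Ks Qs Ps Ls).
- exact: (master_coefS (lqA lq) (lqG lq) (lqQ lq) (lqGam lq) (H t) (S t) (th t) (lqeta lq) Ks Ps Ls).
- exact: (master_coefth (lqA lq) (lqG lq) (H t) (o1 t) (o2 t) (S t) (th t) (tho t) Ks Ps Ls).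
- exact: (master_coefr (lqQ lq) (P t) (Lam t) (H t) (o1 t) (o2 t) (S t) (th t)
    (lqeta lq) (tho t) Ks (lqD lq) (lqD0 lq)).
Qed.

Lemma terminal_star x mu : qfun star_coefs T x mu = term_cost lq x mu
  + \int[mu]_y (delta (term_cost lq y) mu x - delta (term_cost lq y) mu y).
Proof.
have [_ _ [PT LamT HT] [ST thT rT] _] := hc; have [_ _ _ _ [h1T h2T thoT roT]] := ho.
have [Qs _] := lqQf_psd lq.
rewrite terminal_qform qfunE /star_coefs /= /P /Lam /H /S /th /o1 /o2 /tho.
rewrite PT LamT HT ST thT rT h1T h2T thoT roT !sub0r addr0 opprK !trmxN opprK.
by rewrite trmx_mul Qs [- _ + _ *m _]addrC.
Qed.

End Existence.
Theorem theorem5p4 (R : realType) (n n1 n2 n3 : nat)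
    (lq : lq_data R n n1 n2 n3) (T : R) (T_gt0 : 0 < T)
    (P Lam H : R -> 'M[R]_n) (S th : R -> 'cV[R]_n) (r : R -> R)
    (Pi1 Pi2 : R -> 'M[R]_n) (tho : R -> 'cV[R]_n) (ro : R -> R) :
  let c := RiccatiFun P Lam H S th r in
  let o := LinearFun Pi1 Pi2 tho ro in
  is_riccati_solution lq T c ->
  is_linear_solution lq c T o ->
  let Ustar (t : R) (x : 'cV[R]_n) (mu : P2 R n) : R :=
    quad (P t) x
    + \int[mu]_y quad (Pi1 t - H t - (H t)^T) y
    + quad (Pi2 t - Lam t) (mean mu)
    + 2 * dot x ((Lam t + H t + (H t)^T) *m mean mu)
    + 2 * dot x (S t + th t)
    + 2 * dot (mean mu) (tho t)
    + r t + ro t in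
  [/\ quadratic_class T Ustar,
      is_master_solution lq c T Ustar &
      forall U : R -> 'cV[R]_n -> P2 R n -> R,
        quadratic_class T U -> is_master_solution lq c T U ->
        forall (t : R) (x : 'cV[R]_n) (mu : P2 R n),
          0 <= t <= T -> U t x mu = Ustar t x mu].
Proof.
move=> c o hc ho Ustar.
have UstarE t x mu : Ustar t x mu = qfun (star_coefs c o) t x mu.
  by rewrite /Ustar -addrA.
have ode := ode_star hc ho; have sym := sym_star T_gt0 hc ho.
have riccati_sym t : 0 <= t <= T -> sym_mx (rP c t) /\ sym_mx (rLam c t).
  by case: hc => _ _ _ _; exact.
split.
- apply/quadratic_classP; exists (star_coefs c o), (star_derivs lq c o).
  by split; [exact: ode|exact: sym|move=> t x mu _; exact: UstarE].
- split=> [t x mu tT|x mu].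
    have [Ps Ls] := riccati_sym t tT.
    by rewrite (master_rhs_coefs lq x mu T_gt0 tT Ps Ls ode sym) ?(master_star_eq0 T_gt0 hc ho).
  by rewrite UstarE; exact: terminal_star.
move=> U /quadratic_classP[k [d [kd ks Uk]]] [Umaster Uterm] t x mu tT.
rewrite UstarE Uk// !qfunE.
have master0 u y m : 0 <= u <= T -> qfun (master_coefs lq c k d) u y m = 0.
  move=> uT; have [Ps Ls] := riccati_sym u uT.
  by rewrite -(master_rhs_coefs lq y m T_gt0 uT Ps Ls kd ks Uk) -Umaster.
have terminal y m : qfun k T y m = qfun (star_coefs c o) T y m.
  by rewrite (terminal_star hc ho) -Uterm Uk// lexx ltW.
have [[-> -> ->] -> -> -> ->] := master_coefs_unique T_gt0 kd ode ks sym master0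
  (master_star_eq0 T_gt0 hc ho) terminal (closed_loop_bounded T_gt0 hc)
  (Ghat_bounded T_gt0 hc) tT.
by [].
Qed.
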